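(* Let $A$ be a complex abelian variety of CM-type. There exist abelian varieties $A_{\Delta}$ and homomorphisms $f_{\Delta}\colon A\rightarrow A_{\Delta}$ such that every Hodge class $t$ on $A$ can be written as a sum $t=\sum f_{\Delta}^{\ast}(t_{\Delta})$ with $t_{\Delta}$ a Weil class on $A_{\Delta}$.
   Context: For a complex abelian variety $A$, $\mathrm{End}^{0}(A)=\mathrm{End}(A)\otimes_{\mathbb{Z}}\mathbb{Q}$. A CM-algebra is a finite product of CM-fields. A complex abelian variety $A$ is of CM-type if $\mathrm{End}^{0}(A)$ contains a CM-algebra $E$ such that $H^{1}(A,\mathbb{Q})$ is free of rank $1$ as an $E$-module. The symbol $\Delta$ in the claim is an index running over some index set. A Hodge class of degree $p$ on $A$ is an element of $B^{p}(A)=H^{2p}(A,\mathbb{Q})\cap H^{p,p}(A)$. Let $B$ be a complex abelian variety and $\nu\colon E\to \mathrm{End}^{0}(B)$ a homomorphism from a CM-field $E$. The pair $(B,\nu)$ is of Weil type if $H^{1,0}(B)$ is a free $E\otimes_{\mathbb{Q}}\mathbb{C}$-module. In this case $d=\dim_{E}H^{1}(B,\mathbb{Q})$ is even, and the subspace $W_{E}(B)=\bigwedge_{E}^{d}H^{1}(B,\mathbb{Q})$ of $H^{d}(B,\mathbb{Q})=\bigwedge_{\mathbb{Q}}^{d}H^{1}(B,\mathbb{Q})$ consists of Hodge classes; here $W_{E}(B)\otimes_{\mathbb{Q}}\mathbb{C}=\bigoplus_{s\in \mathrm{Hom}(E,\mathbb{C})}\bigwedge^{d}_{\mathbb{C}}H^{1}(B)_{s}$,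 where $H^{1}(B)_{s}$ is the subspace of $H^{1}(B,\mathbb{C})$ on which $E$ acts through $s$. A Weil class on $B$ is an element of $W_{E}(B)$ for some CM-field $E$ and some $\nu$ such that $(B,\nu)$ is of Weil type. *)

(* Defs.v *)
From HB Require Import structures.
From mathcomp Require Import all_boot all_order all_algebra all_field.
From mathcomp Require Import complex reals.

Set Implicit Arguments.
Unset Strict Implicit.
Unset Printing Implicit Defensive.

Import Order.TTheory GRing.Theory Num.Theory.
Local Open Scope ring_scope.
Local Open Scope complex_scope.
Local Open Scope sesquilinear_scope.

(* The complex numbers are R[i] over R : realType.

   A complex abelian variety is a complex torus V/Lambda with V = C^dim (row
   vectors) on which there is a Riemann form.  The rows of [period] generate
   Lambda; the coordinates in these generators identify H_1(A,Z), H_1(A,Q) and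
   H_1(A,C) with row vectors over int, rat and R[i], and x |-> x *m period is
   the projection H_1(A,C) -> V. *)

Record abvar (R : realType) := AbVar {
  dim : nat;
  period : 'M[R[i]]_(dim + dim, dim);
  period_lattice : forall x : 'rV[R]_(dim + dim),
    map_mx (real_complex R) x *m period = 0 -> x = 0;
  period_polarized : exists H : 'M[R[i]]_dim,
    [/\ H \is hermsymmx,
        forall v : 'rV[R[i]]_dim, v != 0 -> 0 < (v *m H *m v ^t*) 0 0 &
        forall i j, complex.Im ((period *m H *m period ^t*) i j) \is a Num.int] }.

Definition rk (R : realType) (A : abvar R) : nat := (dim A + dim A)%N.

(* The analytic representation V -> V' together with the rational one
   Lambda -> Lambda'; each determines the other. *)
Record avhom (R : realType) (A B : abvar R) := Hom {
  hom_an : 'M[R[i]]_(dim A, dim B);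
  hom_rat : 'M[int]_(rk A, rk B);
  hom_compat : period A *m hom_an = map_mx intr hom_rat *m period B }.

(* End^0(A) = End(A) (x) Q, realised by the rational representation as a
   subalgebra of the matrices acting on H_1(A,Q) on the right.  Composition of
   endomorphisms is the reversed matrix product, which does not matter for
   homomorphisms from commutative rings. *)
Definition End0 (R : realType) (A : abvar R) (N : 'M[rat]_(rk A)) : Prop :=
  exists (f : avhom A A) (k : nat),
    (0 < k)%N /\ k%:R *: N = map_mx intr (hom_rat f).

(* H^1(A,F) is the space of columns c, seen as the functional x |-> x *m c;
   an endomorphism with matrix N acts on it by c |-> N *m c. *)

Section Cohomology.
Variables (R : realType) (A : abvar R).

(* H^n(A,C): alternating n-forms on H_1(A,C), as functions of the matrix whose
   rows are the n arguments. *)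
Definition altform n := 'M[R[i]]_(n, rk A) -> R[i].

Definition HC n (t : altform n) : Prop :=
  (forall (i : 'I_n) (X Y Z : 'M_(n, rk A)) b c,
     row i X = b *: row i Y + c *: row i Z ->
     row' i X = row' i Y -> row' i X = row' i Z ->
     t X = b * t Y + c * t Z) /\
  (forall (X : 'M_(n, rk A)) (i j : 'I_n),
     i != j -> row i X = row j X -> t X = 0).

Definition HQ n (t : altform n) : Prop :=
  HC t /\ forall X : 'M[rat]_(n, rk A), exists q : rat,
    t (map_mx ratr X) = ratr q.

(* The exterior product of the columns of L, as elements of H^1(A,C). *)
Definition wedge n (L : 'M[R[i]]_(rk A, n)) : altform n :=
  fun X => \det (X *m L).

Definition Cspan n (G : altform n -> Prop) (t : altform n) : Prop :=
  exists (m : nat) (a : 'I_m -> R[i]) (u : 'I_m -> altform n),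
    (forall k, G (u k)) /\ forall X, t X = \sum_k a k * u k X.

(* H^{1,0} consists of the functionals factoring through H_1(A,C) -> V,
   and H^{0,1} is its complex conjugate. *)
Definition H10 m (L : 'M[R[i]]_(rk A, m)) : Prop :=
  exists P : 'M[R[i]]_(dim A, m), L = period A *m P.

Definition H01 m (L : 'M[R[i]]_(rk A, m)) : Prop :=
  H10 (map_mx Num.conj L).

Definition Hpq p q : altform (p + q) -> Prop :=
  Cspan (fun w => exists (L : 'M_(rk A, p)) (L' : 'M_(rk A, q)),
    [/\ H10 L, H01 L' & w = wedge (row_mx L L')]).

Definition hodge_class p (t : altform (p + p)) : Prop := HQ t /\ Hpq t.

End Cohomology.

Definition pullback (R : realType) (A B : abvar R) (f : avhom A B) n
  (t : altform B n) : altform A n := fun X => t (X *m map_mx intr (hom_rat f)).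

(* The submodule P of M is free of rank m over S acting by [act]. *)
Definition free_of_rank (S : Type) (M : nmodType) (act : S -> M -> M)
  (P : M -> Prop) (m : nat) : Prop :=
  exists b : 'I_m -> M, (forall k, P (b k)) /\
    forall v, P v -> exists! a : {ffun 'I_m -> S}, v = \sum_k act (a k) (b k).

(* A totally imaginary quadratic extension of a totally real number field. *)
Definition CM_field (R : realType) (E : fieldExtType rat) : Prop :=
  (exists F : {subfield E},
     \dim {:E} = (2 * \dim F)%N /\
     forall (s : {rmorphism subvs_of F -> R[i]}) x, s x \is Num.real) /\
  forall s : {rmorphism E -> R[i]}, exists x, s x \isn't Num.real.

(* S is, up to isomorphism, the product of the CM-fields E i; the empty
   product (the zero ring) is allowed. *)
Definition CM_algebra (R : realType) (S : comPzRingType) : Prop :=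
  exists (m : nat) (E : 'I_m -> fieldExtType rat)
         (pr : forall i, {rmorphism S -> E i}),
    (forall i, CM_field R (E i)) /\
    forall x : (forall i, E i), exists! s : S, forall i, pr i s = x i.

Definition CM_type (R : realType) (A : abvar R) : Prop :=
  exists (S : comPzRingType) (nu : {rmorphism S -> 'M[rat]_(rk A)}),
    [/\ CM_algebra R S, injective nu, forall e, End0 (nu e) &
        free_of_rank (fun e (c : 'cV[rat]_(rk A)) => nu e *m c)
                     (fun=> True) 1].

Section Weil.
Variables (R : realType) (B : abvar R) (E : fieldExtType rat).
Variable nu : {rmorphism E -> 'M[rat]_(rk B)}.

Definition nuC (e : E) : 'M[R[i]]_(rk B) := map_mx ratr (nu e).

(* An element of E (x)_Q C is the row a of its coordinates in the C-basis
   e_j (x) 1, where e = vbasis {:E}. *)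
Definition EC_act (a : 'rV[R[i]]_(\dim {:E})) (c : 'cV[R[i]]_(rk B)) :=
  \sum_j a 0 j *: (nuC (tnth (vbasis {:E}) j) *m c).

Definition Weil_type : Prop :=
  [/\ CM_field R E, forall e, End0 (nu e) &
      exists m, free_of_rank EC_act (@H10 R B 1) m].

Definition dimE_H1 (d : nat) : Prop :=
  free_of_rank (fun e (c : 'cV[rat]_(rk B)) => nu e *m c) (fun=> True) d.

(* The columns of L lie in H^1(B)_s. *)
Definition H1_eigen (s : {rmorphism E -> R[i]}) d (L : 'M_(rk B, d)) : Prop :=
  forall e, nuC e *m L = s e *: L.

(* For d = dim_E H^1(B,Q), the subspace W_E(B) of H^d(B,Q) is the rational
   structure of the sum over s of the d-th exterior powers of H^1(B)_s. *)
Definition W_E d (t : altform B d) : Prop :=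
  HQ t /\
  Cspan (fun w => exists (s : {rmorphism E -> R[i]}) (L : 'M_(rk B, d)),
    H1_eigen s L /\ w = wedge L) t.

End Weil.

Definition Weil_class (R : realType) (B : abvar R) d (t : altform B d) : Prop :=
  exists (E : fieldExtType rat) (nu : {rmorphism E -> 'M[rat]_(rk B)}),
    [/\ Weil_type nu, dimE_H1 nu d & W_E nu t].

(* Main.v *)
From HB Require Import structures.
Require Import Defs.
From mathcomp Require Import all_boot all_order all_algebra all_field all_fingroup cyclic.
From mathcomp Require Import complex reals boolp ring lra zify.
Import Defs.
Set Implicit Arguments.
Unset Strict Implicit.
Unset Printing Implicit Defensive.
Import Order.TTheory GRing.Theory Num.Theory.
Local Open Scope ring_scope.

(** Why the theorem is true.

    The CM-algebra acting on [A] is a product of CM-fields [E i], and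
    [H^1(A,Q)] is free of rank one over it.  All the [E i] embed, in all
    possible ways, into one CM-field [K] that is Galois over Q
    ([CM_splitting_field]); this uses that complex conjugation on a CM-field is
    the same algebraic operation under every complex embedding.  Hence the
    action is diagonalized over [K] itself: there is a matrix [P] over [K] whose
    columns [e_j] form a basis of [H^1(A,K)] of common eigenvectors with
    pairwise distinct characters, and under any embedding [s] of [K] in C each
    [s e_j] lies in [H^{1,0}] or in [H^{0,1}] ([CM_eigenbasis]).

    For a word [phi] of length [m] in the index set of this basis, take a
    lattice in [K^m] and define a complex torus [A_phi] with this lattice by
    declaring the functional [x |-> s (x_k)] to be of type (1,0) when
    [s (e_(phi k))] is.  The torus is polarized by a trace form
    [(x, y) |-> Tr (sum_k xi_k x_k conj y_k)], where [xi_k] is a totally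
    imaginary element of [K] whose imaginary parts have the signs dictated by
    the type; it exists because Q is dense in R ([imaginary_element]).  The map
    [x |-> (e_(phi 1) x, .., e_(phi m) x)] is a homomorphism from [A] to
    [A_phi], and [K] acts on [A_phi] by scalars.  The top exterior power over
    [K] of [H^1(A_phi)] is spanned over C by the wedges of the coordinates, one
    for each [s], and these pull back to the wedges of the [s (e_(phi k))].

    Let now [t] be a rational class of degree [q] on [A].  Over [K] it is a
    combination of the wedges [e_phi] with coefficients [c_phi], up to the
    factor [q!] that compensates for summing over words instead of subsets.
    Applying every embedding [s], and averaging, writes [t] as the sum over
    [phi] of the traces of [c_phi e_phi]; each trace is the pullback of a
    rational class in the exterior power over [K] on the variety of [phi]
    ([weil_form]).  It remains to see that a word with [c_phi <> 0] gives a
    variety of Weil type, i.e. that under every [s] exactly half of the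
    [s (e_(phi k))] are of type (1,0).  The coefficient [s c_phi] is the value of
    [t] on vectors of the basis dual to the [s e_j]; if [t] is of type
    (p,p), that value is a combination of determinants in which an imbalance
    of the two types produces a zero block large enough to make them vanish
    ([Hpq_balanced]). *)

(** * Number fields and their embeddings *)

(** Complex algebraic numbers serve only to split [p]; the roots generate a
    number field that is normal because it contains all of them. *)
Lemma splitting_field_exists (p : {poly rat}) : p != 0 ->
  exists (L : splittingFieldType rat) (rs : seq L),
    map_poly (in_alg L) p %= \prod_(z <- rs) ('X - z%:P) /\
    <<1 & rs>>%VS = fullv.
Proof.
move=> nz_p; have [rs Dp] := closed_field_poly_normal (map_poly (ratr : rat -> algC) p).
have [L [LC [s Ds defL]]] := num_field_exists rs.
have splitL : map_poly (in_alg L) p %= \prod_(z <- s) ('X - z%:P).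
  rewrite -(eqp_map LC) -map_poly_comp.
  rewrite (eq_map_poly (g := ratr)); last exact: (fmorph_eq_rat (LC \o in_alg L)).
  rewrite Dp rmorph_prod -Ds big_map /=.
  under [X in _ %= X]eq_bigr do rewrite map_polyXsubC.
  rewrite eqp_scale // lead_coef_eq0 map_poly_eq0 //.
have splL : SplittingField.axiom L.
  exists (map_poly (in_alg L) p); first exact: alg_polyOver.
  by exists s.
pose L' : splittingFieldType rat := HB.pack (L : Type) (FieldExt.on L) (FieldExt_isSplittingField.Build rat L splL).
by exists L', s.
Qed.

(** Every element of [L] is the value at [b] of a rational polynomial [h]; its
    image has to be the value of [h] at [w], and this does not depend on [h]
    because two choices differ by a multiple of the minimal polynomial. *)
Lemma embedding_of_root (L : fieldExtType rat) (T : fieldType)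
    (i : {rmorphism rat -> T}) (b : L) (g : {poly rat}) (w : T) :
  <<1; b>>%VS = fullv -> map_poly (in_alg L) g = minPoly 1 b ->
  root (map_poly i g) w -> exists s : {rmorphism L -> T}, s b = w.
Proof.
move=> genb Dg rw.
have polyb x : {h : {poly rat} | (map_poly (in_alg L) h).[b] == x}.
  have: exists h : {poly rat}, (map_poly (in_alg L) h).[b] == x.
    have /polyOver1P[h Dh] := Fadjoin_polyOver 1 b x.
    by exists h; rewrite -Dh Fadjoin_poly_eq ?genb ?memvf.
  by move/sigW.
pose s x := (map_poly i (sval (polyb x))).[w].
have sE h : s (map_poly (in_alg L) h).[b] = (map_poly i h).[w].
  rewrite /s; have /eqP := svalP (polyb (map_poly (in_alg L) h).[b]); move: (sval _) => h' Dh'.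
  apply/eqP; rewrite -subr_eq0 -hornerN -hornerD -rmorphB.
  have: minPoly 1 b %| map_poly (in_alg L) (h' - h).
    rewrite minPoly_dvdp ?alg_polyOver //.
    by rewrite rmorphB /= rootE !hornerE Dh' subrr.
  rewrite -Dg dvdp_map => dv.
  rewrite -[_ == 0]/(root _ _).
  have: map_poly i g %| map_poly i (h' - h) by rewrite dvdp_map dv.
  by move=> dv'; move: rw; rewrite -!dvdp_XsubCl => /dvdp_trans; apply.
have sP x : exists h, x = (map_poly (in_alg L) h).[b].
  by exists (sval (polyb x)); rewrite (eqP (svalP (polyb x))).
have sB : zmod_morphism s.
  move=> x y; have [h ->] := sP x; have [k ->] := sP y.
  by rewrite -hornerN -hornerD -rmorphB !sE rmorphB /= !hornerE.
have sM : monoid_morphism s.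
  split; first by have := sE 1; rewrite !rmorph1 !hornerE.
  move=> x y; have [h ->] := sP x; have [k ->] := sP y.
  by rewrite -hornerM -rmorphM !sE rmorphM /= !hornerE.
pose s' : {rmorphism L -> T} := HB.pack s (GRing.isZmodMorphism.Build _ _ s sB)
  (GRing.isMonoidMorphism.Build _ _ s sM).
exists s'; have := sE 'X; rewrite !map_polyX !hornerX //.
Qed.

Lemma primitive_generator (L : fieldExtType rat) :
  exists (b : L) (g : {poly rat}), <<1; b>>%VS = fullv /\
     map_poly (in_alg L) g = minPoly 1 b.
Proof.
pose b := separable_generator 1 {:L}.
have sep : separable 1 {:L}.
  apply/separableP => x _; apply: pcharf0_separable => p.
  rewrite (fmorph_pchar (in_alg L)); exact: pchar_num.
exists b; have /polyOver1P[g Dg] := minPolyOver 1 b; exists g; split=> //.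
by rewrite -eq_adjoin_separable_generator ?sub1v.
Qed.

Lemma eq_embedding (L : fieldExtType rat) (T : fieldType) (b : L)
    (u v : {rmorphism L -> T}) : <<1; b>>%VS = fullv -> u b = v b -> u =1 v.
Proof.
move=> genb uvb x.
have /polyOver1P[h Dh] := Fadjoin_polyOver 1 b x.
have -> : x = (map_poly (in_alg L) h).[b] by rewrite -Dh Fadjoin_poly_eq ?genb ?memvf.
rewrite -!horner_map /= uvb -!map_poly_comp; congr (_.[_]).
apply: eq_map_poly => a /=.
by rewrite -[LHS]/((u \o in_alg L) a) -[RHS]/((v \o in_alg L) a) !fmorph_eq_rat.
Qed.

Lemma embedding_exists (L : fieldExtType rat) (T : closedFieldType) (i : {rmorphism rat -> T}) :
  exists t : {rmorphism L -> T}, True.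
Proof.
have [b [g [genb Dg]]] := primitive_generator L.
have /closed_rootP[w rw] : size (map_poly i g) != 1.
  by rewrite size_map_poly -(size_map_poly (in_alg L)) Dg size_minPoly.
by have [t _] := embedding_of_root genb Dg rw; exists t.
Qed.

Lemma galois_rat (K : splittingFieldType rat) : galois 1 {:K}.
Proof.
apply/and3P; split; [exact: sub1v | | exact: normalFieldf].
apply/separableP => x _; apply: pcharf0_separable => p.
by rewrite (fmorph_pchar (in_alg K)) pchar_num.
Qed.

(** The minimal polynomial of [b] already splits over [K], with the conjugates of
    [b] as roots, so that its roots in any field containing a copy of [K] come
    from there. *)
Lemma root_conjugate (K : splittingFieldType rat) (T : fieldType)
  (t : {rmorphism K -> T}) (i : {rmorphism rat -> T}) (g : {poly rat}) (b : K) w :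
  map_poly (in_alg K) g = minPoly 1 b -> root (map_poly i g) w ->
  exists sigma : gal_of {:K}, w = t (sigma b).
Proof.
move=> Dg.
have [r [_ _ /= Db]] := elimT (galois_factors (sub1v _)) (galois_rat K) b (memvf b).
have -> : map_poly i g = map_poly t (minPoly 1 b).
  rewrite -Dg -map_poly_comp; apply: eq_map_poly => a.
  by rewrite fmorph_eq_rat -[RHS]/((t \o in_alg K) a) fmorph_eq_rat.
rewrite Db big_map rmorph_prod /=.
under eq_bigr do rewrite map_polyXsubC.
rewrite -(big_map (fun x : gal_of {:K} => t (x b)) xpredT (fun z => 'X - z%:P)).
rewrite root_prod_XsubC => /mapP[s _ ->]; by exists s.
Qed.

Lemma embedding_conjugate (K : splittingFieldType rat) (T : fieldType)
    (t t' : {rmorphism K -> T}) :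
  exists sigma : gal_of {:K}, forall x, t' x = t (sigma x).
Proof.
have [b [g [genb Dg]]] := primitive_generator K.
have rw : root (map_poly (t' \o in_alg K) g) (t' b).
  by rewrite map_poly_comp fmorph_root Dg root_minPoly.
have [s Ds] := root_conjugate t Dg rw.
exists s => x; exact: (eq_embedding (v := (t \o s)) genb Ds).
Qed.

(** * CM-fields and a common splitting field *)

Section CM.
Variable R : realType.
Local Notation C := (complex R).

(** Write [E] as [F + F z] with [F] totally real.  Under an embedding [u], the
    number [u z] is a non-real root of a real quadratic polynomial, so its
    conjugate is the other root; the other root is [- p - z], whatever [u] is. *)
Lemma CM_conj (E : fieldExtType rat) : CM_field R E ->
  forall x : E, exists y : E, forall u : {rmorphism E -> C}, Num.conj (u x) = u y.
Proof.
case=> [[F [dimE realF]] nreal] x.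
have realu (u : {rmorphism E -> C}) y : y \in F -> Num.conj (u y) = u y.
  move=> Fy; have := realF (u \o vsval) (Subvs Fy).
  by move/CrealP.
have [z Fz] : exists z, z \notin F.
  case: (pselect (exists z, z \notin F)) => // nex.
  have FE : (fullv <= F)%VS.
    apply/subvP => z _; case: (boolP (z \in F)) => // zF.
    by case: nex; exists z.
  have := dimvS FE; rewrite dimE; have := adim_gt0 F.
  by case: (\dim F) => // k _; rewrite mul2n -addnn addnS ltnNge leq_addr.
have deg2 : adjoin_degree F z = 2%N.
  have := dim_Fadjoin F z.
  have le2 : (\dim <<F; z>> <= 2 * \dim F)%N by rewrite -dimE dimvS ?subvf.
  move=> eqd; move: le2; rewrite eqd leq_pmul2r ?adim_gt0 //.
  have : adjoin_degree F z != 1%N by rewrite adjoin_deg_eq1.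
  by rewrite /adjoin_degree; case: (\dim_F _).-1 => [|[|]].
have genz : <<F; z>>%VS = fullv.
  by apply/eqP; rewrite eqEdim subvf dim_Fadjoin deg2 dimE leqnn.
have lin y : exists f g, [/\ f \in F, g \in F & y = f + g * z].
  have /polyOverP Fp := Fadjoin_polyOver F z y.
  exists (Fadjoin_poly F z y)`_0, (Fadjoin_poly F z y)`_1; split=> //.
  rewrite -[LHS](@Fadjoin_poly_eq _ _ F z) ?genz ?memvf //.
  rewrite (@horner_coef_wide _ 2); last by rewrite -deg2 size_Fadjoin_poly.
  by rewrite !big_ord_recr big_ord0 /= add0r mulr1.
have [p [q [Fp Fq Dz2]]] : exists p q, [/\ p \in F, q \in F & z ^+ 2 + p * z + q = 0].
  have /polyOverP Fm := minPolyOver F z.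
  exists (minPoly F z)`_1, (minPoly F z)`_0; split=> //.
  have := minPolyxx F z; rewrite (@horner_coef_wide _ 3) ?size_minPoly ?deg2 //.
  rewrite !big_ord_recr big_ord0 /= add0r mulr1 expr1.
  have := monicP (monic_minPoly F z); rewrite lead_coefE size_minPoly deg2 /= => ->.
  by rewrite mul1r => e0; rewrite -[RHS]e0; ring.
have [f [g [Ff Fg ->]]] := lin x.
exists (f + g * (- p - z)) => u.
have nz : Num.conj (u z) != u z.
  apply/eqP => uz; have [y] := nreal u; have [f' [g' [Ff' Fg' ->]]] := lin y.
  by rewrite CrealE !rmorphD !rmorphM /= uz (realu u f') ?(realu u g') // eqxx.
have -> : Num.conj (u (f + g * z)) = u f + u g * Num.conj (u z).
  by rewrite !rmorphD !rmorphM /= (realu u f) ?(realu u g).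
rewrite rmorphD rmorphM rmorphB rmorphN /=; congr (_ + _ * _).
have e1 : u z ^+ 2 + u p * u z + u q = 0.
  by rewrite -rmorphXn -rmorphM -!rmorphD Dz2 rmorph0.
have e2 : Num.conj (u z) ^+ 2 + u p * Num.conj (u z) + u q = 0.
  have := congr1 Num.conj e1.
  by rewrite !rmorphD rmorphXn !rmorphM /= (realu u p) ?(realu u q) // rmorph0.
have: (Num.conj (u z) - u z) * (Num.conj (u z) + u z + u p) = 0.
  rewrite -[RHS](subrr 0) -{1}e2 -e1; ring.
move/eqP; rewrite mulf_eq0 subr_eq0 (negPf nz) /= -addrA addr_eq0 opprD => /eqP ->.
by rewrite addrC.
Qed.

Lemma conj_sqrt_minus1 (z : C) : z ^+ 2 = -1 -> Num.conj z = - z.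
Proof.
rewrite -sqrCi => /eqP; rewrite eqf_sqr => /orP[]/eqP ->.
  exact: conjCi.
by rewrite rmorphN /= conjCi.
Qed.

Lemma sqrt_minus1_nonreal (z : C) : z ^+ 2 = -1 -> Num.conj z != z.
Proof.
move=> z2; rewrite conj_sqrt_minus1 //; apply/eqP => e.
have: z + z = 0 by rewrite -[X in X + _]e addNr.
move/eqP; rewrite -mulr2n -mulr_natr mulf_eq0 pnatr_eq0 orbF => /eqP z0.
by move: z2; rewrite z0 expr0n /= => /esym/eqP; rewrite oppr_eq0 oner_eq0.
Qed.

(** [iota] is complex conjugation on [K], simultaneously for all embeddings.  For
    a field that contains a square root of -1 this amounts to being a CM-field,
    and it is the form in which the CM property is used below. *)
Definition induces_conj (K : splittingFieldType rat) (iota : gal_of {:K}) :=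
  forall (t : {rmorphism K -> C}) x, Num.conj (t x) = t (iota x).

Lemma embedding_to_C (L : fieldExtType rat) : exists t : {rmorphism L -> C}, True.
Proof. exact: (@embedding_exists L C ratr). Qed.

Lemma induces_conj_involutive (K : splittingFieldType rat) (iota : gal_of {:K}) :
  induces_conj iota -> forall x, iota (iota x) = x.
Proof.
move=> ci x; have [t _] := embedding_to_C K.
by apply: (fmorph_inj t); rewrite -!ci conjCK.
Qed.

(** The totally real subfield is the fixed field of [iota].  An embedding of that
    subfield need not be given as the restriction of one of [K], but the image
    of [x] is a conjugate of [x] in any case, and all conjugates are real. *)
Lemma induces_conj_CM (K : splittingFieldType rat) (iota : gal_of {:K}) (r : K) :
  r ^+ 2 = -1 -> induces_conj iota -> CM_field R K.
Proof.
move=> r2 ci.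
have tr2 (t : {rmorphism K -> C}) : t r ^+ 2 = -1 by rewrite -rmorphXn r2 rmorphN1.
split; last by move=> s; exists r; rewrite CrealE sqrt_minus1_nonreal.
have [t _] := embedding_to_C K.
have ii := induces_conj_involutive ci.
have ord2 : #[iota]%g = 2%N.
  apply: nt_prime_order => //.
    by apply/eqP/gal_eqP => x _; rewrite /= expgS expg1 galM ?memvf // ii gal_id.
  apply/eqP => i1; case/eqP: (sqrt_minus1_nonreal (tr2 t)).
  by rewrite ci i1 gal_id.
have dimK : \dim {:K} = (2 * \dim (fixedField <[iota]>%g))%N.
  have := dim_fixedField <[iota]>%G; rewrite /= -[#|_|]/(#[iota]%g) ord2 => ->.
  by rewrite -dim_sup_field ?subvf.
exists [aspace of fixedField <[iota]>%g]; split=> // s x.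
have Fx : iota (vsval x) = vsval x.
  by move/fixedFieldP: (subvsP x) => /(_ (memvf _)); apply; apply: cycle_id.
have /polyOver1P[g Dg] := minPolyOver 1 (vsval x).
have rx : root (map_poly (s \o in_alg _) g) (s x).
  rewrite map_poly_comp fmorph_root.
  rewrite -(fmorph_root vsval) -map_poly_comp.
  rewrite (eq_map_poly (g := in_alg K)) -?Dg ?root_minPoly //.
  by move=> a; rewrite -[LHS]/((vsval \o in_alg _) a) !fmorph_eq_rat.
have [sg ->] := root_conjugate t (esym Dg) rx.
by rewrite CrealE -[t (sg _)]/((t \o sg) (vsval x)) ci /= Fx.
Qed.

(** A compositum of CM-fields is CM.  [K] is the splitting field of the minimal
    polynomials of primitive elements of the [E i], times [X^2 + 1].  Both
    [t] and its conjugate are embeddings, so conjugation corresponds to some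
    Galois element for each [t] separately; these elements agree for different
    [t], because they agree on the generators of [K], which lie in images of CM-fields
    ([CM_conj]) or square to -1. *)
Lemma CM_splitting_field (m : nat) (E : 'I_m -> fieldExtType rat) :
  (forall i, CM_field R (E i)) ->
  exists (K : splittingFieldType rat) (iota : gal_of {:K}),
    [/\ CM_field R K, induces_conj iota &
      forall i, exists s : 'I_(\dim {:E i}) -> {rmorphism E i -> K},
        forall j j', s j =1 s j' -> j = j'].
Proof.
move=> CME.
have [b /fin_all_exists[g gP]] := fin_all_exists (fun i => primitive_generator (E i)).
pose p : {poly rat} := ('X^2 + 1) * \prod_i g i.
have nzg i : g i != 0.
  have [_ Dg] := gP i; rewrite -(map_poly_eq0 (in_alg (E i))) Dg.
  exact/monic_neq0/monic_minPoly.
have nzp : p != 0.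
  rewrite mulf_neq0 //; last by apply/prodf_neq0.
  by apply/monic_neq0; rewrite -[1]opprK -polyCN; apply: monicXnsubC.
have [K [rs [splitp genrs]]] := splitting_field_exists nzp.
have splits (q : {poly rat}) : q %| p ->
    exists qs : seq K, map_poly (in_alg K) q %= \prod_(z <- qs) ('X - z%:P).
  move=> qp.
  have : map_poly (in_alg K) q %| \prod_(z <- rs) ('X - z%:P).
    by rewrite -(eqp_dvdr _ splitp) dvdp_map.
  by case/dvdp_prod_XsubC => ms e; exists (mask ms rs).
have sepg i : separable_poly (g i).
  rewrite -(separable_map (in_alg (E i))); have [_ ->] := gP i.
  rewrite -/(separable_element 1 (b i)); apply: pcharf0_separable => q.
  by rewrite (fmorph_pchar (in_alg (E i))) pchar_num.
have [r r2] : exists r : K, r ^+ 2 = -1.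
  have [qs eqs] := splits ('X^2 + 1) (dvdp_mulr _ (dvdpp _)).
  have szq : size qs = 2%N.
    have := eqp_size eqs; rewrite size_map_poly size_prod_XsubC.
    have -> : 'X^2 + 1 = 'X^2 - (-1)%:P :> {poly rat} by rewrite polyCN opprK.
    by rewrite size_XnsubC // => -[].
  case: qs szq eqs => // r qs _ eqs; exists r.
  have: root (map_poly (in_alg K) ('X^2 + 1)) r.
    by rewrite (eqp_root eqs) root_prod_XsubC mem_head.
  rewrite rmorphD rmorphXn rmorph1 /= map_polyX rootE !hornerE addr_eq0.
  by move/eqP.
have [t _] := embedding_to_C K.
have [iota ci] := embedding_conjugate t (Num.conj \o t).
have rootsP z : z \in rs -> z ^+ 2 = -1 \/ exists i (s : {rmorphism E i -> K}), z = s (b i).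
  rewrite -root_prod_XsubC -(eqp_root splitp) rmorphM rootM => /orP[].
    rewrite rmorphD rmorphXn rmorph1 /= map_polyX rootE !hornerE addr_eq0.
    by move/eqP; left.
  rewrite rmorph_prod rootE horner_prod prodf_seq_eq0 => /hasP[i _ /= ri]; right; exists i.
  have [gen Dg] := gP i; have [s <-] := embedding_of_root gen Dg ri.
  by exists s.
have conjK : induces_conj iota.
  move=> t'; have [iota' ci'] := embedding_conjugate t' (Num.conj \o t').
  suff -> : iota = iota' by move=> x; apply: ci'.
  have genb i : exists y, forall u : {rmorphism E i -> C}, Num.conj (u (b i)) = u y.
    exact: CM_conj.
  pose d := (iota' * iota^-1)%g.
  have Frs z : z \in rs -> z \in fixedField [set d].
    move=> zrs; apply/fixedFieldP; first exact: memvf.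
    move=> _ /set1P->; rewrite /d galM ?memvf //.
    suff -> : iota' z = iota z.
      by rewrite -galM ?memvf // mulgV gal_id.
    case: (rootsP z zrs) => [z2|[i [s ->]]].
      have e1 : iota z = - z.
        apply: (fmorph_inj t); rewrite -ci rmorphN /=.
        by apply: conj_sqrt_minus1; rewrite -rmorphXn z2 rmorphN1.
      rewrite e1; apply: (fmorph_inj t'); rewrite -ci' rmorphN /=.
      by apply: conj_sqrt_minus1; rewrite -rmorphXn z2 rmorphN1.
    have [y yP] := genb i.
    have -> : iota (s (b i)) = s y.
      by apply: (fmorph_inj t); rewrite -ci /=; apply: (yP (t \o s)).
    by apply: (fmorph_inj t'); rewrite -ci' /=; apply: (yP (t' \o s)).
  have Ffull : (fullv <= fixedField [set d])%VS.
    suff: (<<1 & rs>> <= fixedField [set d])%VS by rewrite {1}genrs.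
    by apply/Fadjoin_seqP; split; [exact: sub1v | exact: Frs].
  have d1 : d = 1%g.
    apply/eqP/gal_eqP => x _; rewrite gal_id.
    have /fixedFieldP := subvP Ffull x (memvf x).
    by move/(_ (memvf _)); apply; apply: set11.
  by move/eqP: d1; rewrite /d -eq_mulgV1 => /eqP.
exists K, iota; split=> //; first exact: (induces_conj_CM r2).
move=> i; have [gen Dg] := gP i.
have gi_dvd : g i %| p.
  by rewrite dvdp_mull // (bigD1 i) //= dvdp_mulr.
have [qs eqs] := splits _ gi_dvd.
have Uqs : uniq qs.
  by rewrite -separable_prod_XsubC -(eqp_separable eqs) separable_map.
have szq : size qs = \dim {:E i}.
  have := eqp_size eqs; rewrite size_map_poly size_prod_XsubC.
  by rewrite -(size_map_poly (in_alg (E i))) Dg size_minPoly adjoin_degreeE gen dimv1 divn1 => -[].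
have ex (j : 'I_(\dim {:E i})) : exists s : {rmorphism E i -> K}, s (b i) = qs`_j.
  apply: (embedding_of_root (i := in_alg K) gen Dg).
  by rewrite (eqp_root eqs) root_prod_XsubC mem_nth // szq.
have /fin_all_exists[s sP] := ex; exists s => j j' /(_ (b i)).
rewrite !sP => /eqP; rewrite nth_uniq ?szq // => /eqP; exact: val_inj.
Qed.

End CM.

(** * Embeddings of a Galois CM-field *)

(** Multiplying the argument of a vanishing combination by [y] and subtracting
    [chi k y] times the original relation eliminates [chi k]. *)
Lemma dedekind_independence (M : pzRingType) (F : fieldType) (I : finType)
    (chi : I -> {rmorphism M -> F}) (c : I -> F) :
  (forall i j, chi i =1 chi j -> i = j) ->
  (forall x, \sum_i c i * chi i x = 0) -> forall i, c i = 0.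
Proof.
move=> chi_inj.
suff gen (s : seq I) : uniq s -> forall c : I -> F,
    (forall x, \sum_(i <- s) c i * chi i x = 0) -> forall i, i \in s -> c i = 0.
  move=> sum0 i; apply: (gen (index_enum I) (index_enum_uniq _) c sum0).
  exact: mem_index_enum.
elim: s => // k s IHs /= /andP[ks Us] {}c sum0.
have c0 i : i \in s -> c i = 0.
  move=> si; case: (pselect (chi i =1 chi k)) => [e|ne].
    by rewrite -(chi_inj _ _ e) si in ks.
  have [y ney] : exists y, chi i y != chi k y.
    case: (pselect (exists y, chi i y != chi k y)) => // nex.
    by case: ne => y; apply/eqP; apply: contrapT => /negP h; apply: nex; exists y.
  have := IHs Us (fun j => c j * (chi j y - chi k y)) _ i si.
  move=> h; apply/eqP; move: h; set P := (X in (X -> _) -> _) => h.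
  suff /h/eqP : P by rewrite mulf_eq0 subr_eq0 (negPf ney) orbF.
  move=> x; have e1 := sum0 (y * x); have e2 := sum0 x.
  rewrite !big_cons rmorphM in e1 e2.
  transitivity (\sum_(j <- s) c j * chi j (y * x) - chi k y * \sum_(j <- s) c j * chi j x).
    rewrite mulr_sumr -sumrB; apply: eq_bigr => j _.
    by rewrite rmorphM; ring.
  move/eqP: e1; rewrite addrC addr_eq0 => /eqP->.
  by move/eqP: e2; rewrite addrC addr_eq0 => /eqP->; ring.
move=> i; rewrite inE => /predU1P[->|]; last exact: c0.
have := sum0 1; rewrite big_cons rmorph1 mulr1 big_seq big1 ?addr0 //.
by move=> j sj; rewrite c0 // mul0r.
Qed.

Section Embeddings.
Variable R : realType.
Local Notation C := (complex R).
Variables (K : splittingFieldType rat) (iota : gal_of {:K}).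
Hypothesis ci : induces_conj R iota.
Variable t0 : {rmorphism K -> C}.

(** [K] being Galois, these are all the embeddings of [K] in C, once one of them
    is chosen.  The definition is locked to keep simplification from exposing [t0]. *)
Definition emb := locked (fun s : gal_of {:K} => t0 \o s : {rmorphism K -> C}).

Lemma embE s x : emb s x = t0 (s x).
Proof. by rewrite /emb -lock. Qed.

Lemma conj_emb s x : Num.conj (emb s x) = emb (iota * s)%g x.
Proof. by rewrite ci !embE galM ?memvf. Qed.

Lemma emb_conj s x : Num.conj (emb s x) = emb s (iota x).
Proof. exact: ci. Qed.

Lemma emb_rat s a : emb s a%:A = ratr a.
Proof. by rewrite -[LHS]/((emb s \o in_alg K) a) fmorph_eq_rat. Qed.

Lemma embZ s a x : emb s (a *: x) = ratr a * emb s x.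
Proof. by rewrite -mulr_algl rmorphM emb_rat. Qed.

Lemma emb_inj_index s s' : emb s =1 emb s' -> s = s'.
Proof.
move=> e; apply/eqP/gal_eqP => x _; by apply: (fmorph_inj t0); rewrite -!embE.
Qed.

Lemma gal_full : 'Gal({:K} / 1)%g = [set: gal_of {:K}].
Proof. by apply/setP => s; rewrite gal_kHom ?sub1v // inE k1AHom. Qed.

Lemma card_gal : #|{: gal_of {:K}}| = \dim {:K}.
Proof.
by have := galois_dim (galois_rat K); rewrite dimv1 divn1 gal_full cardsT.
Qed.

(** The sum is the image of a Galois-invariant element. *)
Lemma trace_rat x : exists q : rat, \sum_s emb s x = ratr q.
Proof.
have /vlineP[q Dq] := mem_galTrace (galois_rat K) (memvf x).
exists q; rewrite -(emb_rat 1%g) -Dq embE gal_id /galTrace rmorph_sum /=.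
by rewrite gal_full; apply: eq_big => s; rewrite ?inE ?embE.
Qed.

Local Notation n := (\dim {:K}).
Local Notation e := (tnth (vbasis {:K})).

Lemma vbasis_sum (x : K) : x = \sum_j coord (vbasis {:K}) j x *: e j.
Proof.
by rewrite {1}(coord_vbasis (memvf x)); apply: eq_bigr => j _; rewrite (tnth_nth 0).
Qed.

(** The isomorphism of K (x) C with the product of copies of C, in coordinates. *)
Definition emb_mx : 'M[C]_(n, #|{: gal_of {:K}}|) := \matrix_(j, k) emb (enum_val k) (e j).

Lemma rank_emb_mx : \rank emb_mx = n.
Proof.
suff: row_free emb_mx^T by move/eqP; rewrite mxrank_tr => ->; exact: card_gal.
apply: inj_row_free => v v0; apply/rowP => k; rewrite mxE.
pose c s := v 0 (enum_rank s).
have -> : v 0 k = c (enum_val k) by rewrite /c enum_valK.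
apply: (dedekind_independence (chi := emb)); first exact: emb_inj_index.
move=> x; rewrite (vbasis_sum x).
under eq_bigr do rewrite rmorph_sum mulr_sumr.
rewrite exchange_big big1 // => j _.
under eq_bigr do rewrite embZ mulrCA.
rewrite -mulr_sumr (reindex_onto enum_val enum_rank) /=; last by move=> s _; rewrite enum_rankK.
have := congr1 (fun A : 'rV_ _ => A 0 j) v0; rewrite !mxE => v0j.
rewrite [X in _ * X](_ : _ = 0) ?mulr0 // -[RHS]v0j; apply: eq_big => i.
  by rewrite enum_valK eqxx.
by rewrite /c enum_valK !mxE.
Qed.

Lemma emb_coord_inj (x : 'I_n -> C) :
  (forall s, \sum_j x j * emb s (e j) = 0) -> forall j, x j = 0.
Proof.
move=> x0 j; suff: \row_j x j = 0 by move/rowP/(_ j); rewrite !mxE.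
apply: (row_free_inj (m := 1) (A := emb_mx)); first by rewrite /row_free rank_emb_mx.
rewrite mul0mx; apply/rowP => k; rewrite !mxE -[RHS](x0 (enum_val k)).
by apply: eq_bigr => i _; rewrite !mxE.
Qed.

Lemma emb_coord_surj (y : gal_of {:K} -> C) :
  exists x : 'I_n -> C, forall s, \sum_j x j * emb s (e j) = y s.
Proof.
have full : row_full emb_mx by rewrite /row_full rank_emb_mx card_gal.
have /submxP[x Dx] := submx_full (\row_k y (enum_val k)) full.
exists (x 0) => s; have := congr1 (fun A : 'rV_ _ => A 0 (enum_rank s)) Dx.
rewrite !mxE enum_rankK => ->; apply: eq_bigr => j _.
by rewrite !mxE enum_rankK.
Qed.

Lemma rat_approx (x d : C) : x \is Num.real -> 0 < d -> exists q : rat, `|x - ratr q| < d.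
Proof.
move=> /complex_realP[a ->] d0.
have /complex_realP[b Db] : d \is Num.real by rewrite gtr0_real.
have b0 : 0 < b by rewrite Db ltcR in d0.
have : a < a + b by rewrite ltrDl.
case/rat_in_itvoo => q; rewrite in_itv /= => /andP[aq qb].
exists q; rewrite -(fmorph_eq_rat (real_complex R \o ratr)) /= -rmorphB.
rewrite normc_def /= expr0n addr0 sqrtr_sqr Db ltcR ltr_norml.
by apply/andP; split; lra.
Qed.

Lemma rotated_imag_pos (z : C) : `|z - 'i| < 1 -> 0 < - 'i * (z - Num.conj z).
Proof.
move=> lt1; pose d := z - 'i.
have -> : z = 'i + d by rewrite /d addrC subrK.
rewrite rmorphD /= conjCi.
have -> : - 'i * ('i + d - (- 'i + Num.conj d)) = 2 - 'i * (d - Num.conj d).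
  transitivity (- 'i ^+ 2 * 2 - 'i * (d - Num.conj d) : C); first ring.
  by rewrite sqrCi opprK mul1r.
rewrite subr_gt0.
apply: le_lt_trans (_ : _ <= `|d| + `|d|) _; last first.
  have -> : 2 = 1 + 1 :> C by ring.
  by rewrite ltrD.
have real : 'i * (d - Num.conj d) \is Num.real.
  by rewrite CrealE rmorphM rmorphB /= conjCK conjCi; apply/eqP; ring.
apply: le_trans (real_ler_norm real) _.
rewrite normrM normCi mul1r; apply: le_trans (ler_normB _ _) _.
by rewrite norm_conjC.
Qed.

(** Over R instead of Q, the system asking that [emb s x] be [i] or [-i] according
    to [eps] has a solution: it is solvable over C by [emb_coord_surj], and the
    solution is real by uniqueness, since [eps] changes sign under [iota].  A
    close enough rational approximation has imaginary parts of the same signs,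
    and subtracting its conjugate removes the real parts. *)
Lemma imaginary_element (eps : gal_of {:K} -> bool) :
  (forall s, eps (iota * s)%g = ~~ eps s) ->
  exists xi : K, iota xi = - xi /\ forall s, eps s -> 0 < - 'i * emb s xi.
Proof.
move=> epsN.
(* The prescribed values of the embeddings at the real solution. *)
pose y s : C := if eps s then 'i else - 'i.
have [x Dx] := emb_coord_surj y.
have realx j : x j \is Num.real.
  rewrite CrealE -subr_eq0; apply/eqP; move: j.
  apply: emb_coord_inj => s; under eq_bigr do rewrite mulrBl.
  rewrite sumrB Dx; apply/eqP; rewrite subr_eq0; apply/eqP.
  have -> : s = (iota * (iota^-1 * s))%g by rewrite mulKVg.
  move: (iota^-1 * s)%g => {}s.
  under eq_bigr do rewrite -conj_emb -rmorphM.
  rewrite -rmorph_sum Dx /y epsN; case: (eps s) => /=; first exact: conjCi.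
  by rewrite rmorphN /= conjCi opprK.
(* An error of at most [d = 1 / (1 + B)] in each coordinate moves the value of every
   embedding by less than 1. *)
pose B : C := \sum_s \sum_j `|emb s (e j)|.
have B0 : 0 <= B by do 2!apply: sumr_ge0 => ? _.
pose d := (1 + B)^-1.
have B1 : 0 < 1 + B by rewrite ltr_wpDr.
have d0 : 0 < d by rewrite invr_gt0.
have /fin_all_exists[q Dq] := fun j => rat_approx (realx j) d0.
pose eta := \sum_j q j *: e j.
have close s : `|emb s eta - y s| < 1.
  have -> : emb s eta = \sum_j ratr (q j) * emb s (e j).
    by rewrite rmorph_sum; apply: eq_bigr => j _; exact: embZ.
  rewrite -Dx -sumrB.
  apply: le_lt_trans (ler_norm_sum _ _ _) _.
  apply: le_lt_trans (_ : _ <= d * B) _; last first.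
    by rewrite mulrC ltr_pdivrMr // mul1r ltrDr.
  rewrite /B mulr_sumr (bigD1 s) //= -[X in X <= _]addr0 lerD //; last first.
    apply: sumr_ge0 => ? _; apply: mulr_ge0; [exact: ltW | by apply: sumr_ge0].
  rewrite mulr_sumr; apply: ler_sum => j _.
  rewrite -mulrBl normrM ler_wpM2r // distrC; exact/ltW/Dq.
exists (eta - iota eta); split.
  by rewrite rmorphB /= (induces_conj_involutive ci) opprB.
move=> s es; have -> : emb s (eta - iota eta) = emb s eta - Num.conj (emb s eta).
  by rewrite emb_conj rmorphB.
by apply: rotated_imag_pos; have := close s; rewrite /y es.
Qed.
End Embeddings.

(** * The Hodge decomposition in degree one *)

Section HodgeDecomposition.
Variables (R : realType) (A : abvar R).
Local Notation C := (complex R).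
Local Notation cj := (map_mx (@Num.conj C)).

Lemma map_conjK m n (M : 'M[C]_(m, n)) : cj (cj M) = M.
Proof. by apply/matrixP => i j; rewrite !mxE conjCK. Qed.

(** Its columns are the coordinates of V and their conjugates, that is, a basis of
    [H^1(A,C)] adapted to the Hodge decomposition. *)
Definition full_period : 'M[C]_(dim A + dim A) := row_mx (period A) (cj (period A)).

(** If [v] is killed by the periods and by their conjugates, so is the conjugate
    of [v], hence so are its real and imaginary parts, which vanish because the
    lattice spans V over R. *)
Lemma full_period_unit : full_period \in unitmx.
Proof.
rewrite -row_free_unit; apply: inj_row_free => v.
rewrite /full_period mul_mx_row => e0.
have [v1 v2] := eq_row_mx (etrans e0 (esym (row_mx0 _ _ _ _))).
have v2' : cj v *m period A = 0 by rewrite -[LHS]map_conjK map_mxM map_conjK /= v2 map_mx0.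
have sum0 (w : 'rV[C]_(dim A + dim A)) : w *m period A = 0 ->
    (forall i, w 0 i \is Num.real) -> w = 0.
  move=> w0 rw; pose x := map_mx (@complex.Re R) w.
  have wx : w = map_mx (real_complex R) x.
    by apply/rowP => i; rewrite !mxE; have /RRe_real := rw i.
  by have := @period_lattice R A x; rewrite -wx => /(_ w0) x0; rewrite wx x0 map_mx0.
have s1 : v + cj v = 0.
  apply: sum0 => [|i]; first by rewrite mulmxDl v1 v2' addr0.
  by rewrite !mxE CrealE rmorphD /= conjCK addrC.
have s2 : 'i *: (v - cj v) = 0.
  apply: sum0 => [|i]; first by rewrite -scalemxAl mulmxBl v1 v2' subr0 scaler0.
  by rewrite !mxE CrealE rmorphM rmorphB /= conjCK conjCi; apply/eqP; ring.
have {}s2 : v - cj v = 0 by rewrite -[LHS](scalerK (neq0Ci C)) s2 scaler0.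
have : v *+ 2 = 0 by rewrite mulr2n -[X in _ + X](subrK (cj v)) s2 add0r s1.
by move/eqP; rewrite -scaler_nat scaler_eq0 pnatr_eq0 => /eqP.
Qed.

Lemma H01E m (L : 'M[C]_(rk A, m)) :
  H01 L <-> exists P : 'M_(dim A, m), L = cj (period A) *m P.
Proof.
split=> [[P e]|[P e]]; exists (cj P); first by rewrite -[L]map_conjK e map_mxM.
by rewrite e map_mxM /= map_conjK.
Qed.

Lemma period_free m (P Q : 'M_(dim A, m)) :
  period A *m P + cj (period A) *m Q = 0 -> P = 0 /\ Q = 0.
Proof.
rewrite -mul_row_col -/full_period => /(congr1 (mulmx (invmx full_period))).
rewrite mulKmx ?full_period_unit // mulmx0 => e.
exact: eq_col_mx (etrans e (esym (col_mx0 _ _ _ _))).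
Qed.

Lemma H10_H01_0 m (L : 'M[C]_(rk A, m)) : H10 L -> H01 L -> L = 0.
Proof.
case=> P e /H01E[P' e'].
have [|P0 _] := @period_free _ P (- P'); first by rewrite mulmxN -e -e' subrr.
by rewrite e P0 mulmx0.
Qed.

Lemma period_inj m (P : 'M_(dim A, m)) : period A *m P = 0 -> P = 0.
Proof.
move=> e; have [|-> _] // := @period_free _ P 0.
by rewrite mulmx0 addr0.
Qed.

Lemma H10_H01_split m (L : 'M[C]_(rk A, m)) :
  exists L1 L2, [/\ H10 L1, H01 L2 & L = L1 + L2].
Proof.
pose Q := invmx full_period *m (L : 'M_(dim A + dim A, m)).
exists (period A *m usubmx Q), (cj (period A) *m dsubmx Q); split.
- by eexists.
- by apply/H01E; eexists.
by rewrite -mul_row_col vsubmxK mulKVmx ?full_period_unit.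
Qed.

Lemma H10_mulr m p (L : 'M[C]_(rk A, m)) (M : 'M_(m, p)) : H10 L -> H10 (L *m M).
Proof. by case=> P ->; exists (P *m M); rewrite mulmxA. Qed.

Lemma H01_mulr m p (L : 'M[C]_(rk A, m)) (M : 'M_(m, p)) : H01 L -> H01 (L *m M).
Proof. by case/H01E=> P ->; apply/H01E; exists (P *m M); rewrite mulmxA. Qed.

Lemma H10B m (L M : 'M[C]_(rk A, m)) : H10 L -> H10 M -> H10 (L - M).
Proof. by case=> P -> [Q ->]; exists (P - Q); rewrite mulmxBr. Qed.

Lemma H01B m (L M : 'M[C]_(rk A, m)) : H01 L -> H01 M -> H01 (L - M).
Proof. by case/H01E=> P -> /H01E[Q ->]; apply/H01E; exists (P - Q); rewrite mulmxBr. Qed.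

Lemma H10Z m a (L : 'M[C]_(rk A, m)) : H10 L -> H10 (a *: L).
Proof. by case=> P ->; exists (a *: P); rewrite scalemxAr. Qed.

Lemma H01Z m a (L : 'M[C]_(rk A, m)) : H01 L -> H01 (a *: L).
Proof. by case/H01E=> P ->; apply/H01E; exists (a *: P); rewrite scalemxAr. Qed.

Lemma ratr_mx_intr m n (M : 'M[int]_(m, n)) :
  map_mx (ratr : rat -> C) (map_mx intr M) = map_mx intr M.
Proof. by apply/matrixP => i j; rewrite !mxE ratr_int. Qed.

Lemma End0_H10 N m (L : 'M[C]_(rk A, m)) : End0 N -> H10 L -> H10 (map_mx ratr N *m L).
Proof.
case=> f [k [k0 e]] [P ->].
have nz : k%:R != 0 :> C by rewrite pnatr_eq0 -lt0n.
exists (k%:R^-1 *: (hom_an f *m P)).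
have := congr1 (map_mx (ratr : rat -> C)) e; rewrite map_mxZ ratr_mx_intr /= ratr_nat => e'.
rewrite -[map_mx ratr N](scalerK nz) e' -scalemxAl -scalemxAr.
by rewrite mulmxA -hom_compat mulmxA.
Qed.

Lemma End0_H01 N m (L : 'M[C]_(rk A, m)) : End0 N -> H01 L -> H01 (map_mx ratr N *m L).
Proof.
move=> EN HL; rewrite /H01 map_mxM /= -map_mx_comp.
rewrite (eq_map_mx _ (fmorph_eq_rat (Num.conj \o ratr))).
exact: End0_H10.
Qed.

Lemma H10_cols m (L : 'M[C]_(rk A, m)) : (forall j, H10 (col j L)) -> H10 L.
Proof.
move=> /fin_all_exists[P PE]; exists (\matrix_(i, j) P j i 0).
apply/matrixP => i j; have := congr1 (fun M : 'cV_ _ => M i 0) (PE j); rewrite !mxE => ->.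
by apply: eq_bigr => k _; rewrite !mxE.
Qed.

Lemma H01_cols m (L : 'M[C]_(rk A, m)) : (forall j, H01 (col j L)) -> H01 L.
Proof. by move=> h; apply: H10_cols => j; have := h j; rewrite /H01 map_col. Qed.
End HodgeDecomposition.

(** * An eigenbasis for an abelian variety of CM-type *)

Lemma common_denominator (I : finType) (q : I -> rat) :
  exists2 N : nat, (0 < N)%N & forall i, N%:R * q i \is a Num.int.
Proof.
exists (\prod_i `|denq (q i)|%N)%N.
  by apply: prodn_gt0 => i; rewrite absz_gt0 denq_neq0.
move=> i; rewrite (bigD1 i) //= mulnC natrM -mulrA rpredM ?natr_int //.
rewrite natr_absz gtr0_norm ?denq_gt0 // mulrC -numqE; exact: intr_int.
Qed.

Lemma CM_algebra_surj (S : comPzRingType) m (E : 'I_m -> fieldExtType rat)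
  (pr : forall i, {rmorphism S -> E i}) :
  (forall x : (forall i, E i), exists! s : S, forall i, pr i s = x i) ->
  forall i (y : E i), exists s, pr i s = y /\ forall j, j != i -> pr j s = 0.
Proof.
move=> bij i y; have [s [sP _]] := bij (dfwith (fun j => 0 : E j) y).
by exists s; split=> [|j ji]; rewrite sP ?dfwith_in ?dfwith_out // eq_sym.
Qed.

Section Eigenbasis.
Variables (R : realType) (A : abvar R).
Local Notation C := (complex R).

(** Evaluation at a generator [c0] identifies the CM-algebra with [H^1(A,Q)];
    [ev] is the inverse of this evaluation. *)
Lemma CM_type_coordinates : CM_type A ->
  exists (S : comPzRingType) (nu : {rmorphism S -> 'M[rat]_(rk A)})
    (m : nat) (E : 'I_m -> fieldExtType rat) (pr : forall i, {rmorphism S -> E i})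
    (ev : 'cV[rat]_(rk A) -> S) (c0 : 'cV[rat]_(rk A)),
  [/\ forall i, CM_field R (E i),
      forall x : (forall i, E i), exists! s : S, forall i, pr i s = x i,
      forall s, End0 (nu s), cancel ev (fun s => nu s *m c0) &
      cancel (fun s => nu s *m c0) ev].
Proof.
case=> S [nu [[m [E [pr [CME bij]]]] injnu End [b [_ bP]]]].
have evP v : exists s, nu s *m b 0 = v /\ forall s', nu s' *m b 0 = v -> s' = s.
  have [a [Da Ua]] := bP v I; exists (a 0).
  split=> [|s' Ds']; first by rewrite Da big_ord1.
  have -> : a = [ffun _ => s'] by apply: Ua; rewrite big_ord1 ffunE.
  by rewrite ffunE.
have [ev ev_spec] := choice evP.
exists S, nu, m, E, pr, ev, (b 0); split=> // [v|s].
  by have [] := ev_spec v.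
by have [_ U] := ev_spec (nu s *m b 0); rewrite -(U s).
Qed.

(** The characters [chi] of the CM-algebra with values in [K] are linear
    functionals on [H^1(A,Q)], through [ev]; they are independent by Dedekind, and
    there are at least [rk A] of them, since [H^1(A,Q)] embeds in the product of
    the [E i].  The basis dual to [rk A] of them consists of eigenvectors.  Over
    C the eigenspaces are lines, and the CM-algebra preserves both [H^{1,0}] and
    [H^{0,1}], so the two components of an eigenvector are proportional to it,
    and one of them is zero. *)
Theorem CM_eigenbasis : CM_type A ->
  exists (K : splittingFieldType rat) (iota : gal_of {:K}) (P : 'M[K]_(rk A)),
  [/\ CM_field R K, induces_conj R iota, P \in unitmx,
      forall i j k, coord (vbasis {:K}) k (P i j) \is a Num.int &
      forall (t : {rmorphism K -> C}) j,
        H10 (col j (map_mx t P)) \/ H01 (col j (map_mx t P))].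
Proof.
case/CM_type_coordinates=> S [nu [m [E [pr [ev [c0 [CME bij End evK Kev]]]]]]].
have [K [iota [CMK ci embE]]] := CM_splitting_field CME.
exists K, iota.
have [s s_inj] := fin_all_exists embE.
have evB : zmod_morphism ev.
  move=> v w; rewrite -[RHS]Kev; congr ev.
  by rewrite rmorphB mulmxBl !evK.
have ev_nu x v : ev (nu x *m v) = x * ev v.
  by rewrite -[RHS]Kev rmorphM -mulmxA evK.
pose psi i v := pr i (ev v).
have psiB i : zmod_morphism (psi i) by move=> v w; rewrite /psi evB rmorphB.
have psiZ i := rat_linear (psiB i).
have psiL i (I : Type) (r : seq I) (a : I -> rat) (v : I -> 'cV[rat]_(rk A)) :
    psi i (\sum_(k <- r) a k *: v k) = \sum_(k <- r) a k *: psi i (v k).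
  pose f : {additive 'cV[rat]_(rk A) -> E i} :=
    HB.pack (psi i) (GRing.isZmodMorphism.Build _ _ (psi i) (psiB i)).
  rewrite -[LHS]/(f _) raddf_sum; apply: eq_bigr => k _; exact: psiZ.
pose J := {i : 'I_m & 'I_(\dim {:E i})}.
pose chi (x : J) : {rmorphism S -> K} := s (tag x) (tagged x) \o pr (tag x).
have chi_inj x y : chi x =1 chi y -> x = y.
  case: x y => [i j] [i' j'] /= e.
  have ii' : i = i'.
    apply/eqP/negP => /negP ne; have [z [z1 z0]] := CM_algebra_surj bij (1 : E i).
    have := e z; rewrite /chi /= z1 rmorph1 z0 1?eq_sym // rmorph0 => /eqP.
    by rewrite oner_eq0.
  case: i' / ii' j' e => j' e; congr (existT _ _ _).
  apply: s_inj => y; have [z [<- _]] := CM_algebra_surj bij y; exact: e.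
pose dl (k : 'I_(rk A)) : 'cV[rat]_(rk A) := delta_mx k 0.
have dlE (v : 'cV[rat]_(rk A)) : v = \sum_k v k 0 *: dl k.
  apply/colP => k; rewrite summxE (bigD1 k) //= !mxE !eqxx mulr1 big1 ?addr0 //.
  by move=> l lk; rewrite !mxE eq_sym (negPf lk) mulr0.
have chiL x (v : 'cV[rat]_(rk A)) : chi x (ev v) = \sum_k (v k 0)%:A * chi x (ev (dl k)).
  rewrite {1}(dlE v) -[LHS]/(s _ _ (psi _ _)) psiL rmorph_sum.
  apply: eq_bigr => k _.
  rewrite -[X in s _ _ X](mulr_algl (v k 0)) rmorphM; congr (_ * _).
  rewrite -[LHS]/((s (tag x) (tagged x) \o in_alg _) _) fmorph_eq_rat.
  by rewrite -[RHS]/(in_alg K _) fmorph_eq_rat.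
(* The coordinates of the components in the [E i] embed [H^1(A,Q)]. *)
have leJ : (rk A <= #|{: J}|)%N.
  pose G : 'M[rat]_(rk A, #|{: J}|) :=
    \matrix_(k, l) coord (vbasis {:E (tag (enum_val l))}) (tagged (enum_val l))
       (psi _ (dl k)).
  suff /eqP <- : row_free G by apply: rank_leq_col.
  apply: inj_row_free => v v0; apply: trmx_inj; rewrite trmx0.
  have psi0 i : psi i v^T = 0.
    rewrite (coord_vbasis (memvf (psi i v^T))) big1 // => j _.
    have := congr1 (fun M : 'rV_ _ => M 0 (enum_rank (existT _ i j : J))) v0.
    rewrite !mxE => e; rewrite [X in X *: _](_ : _ = 0) ?scale0r // -[RHS]e.
    rewrite {1}(dlE v^T) psiL linear_sum /=; apply: eq_bigr => k _.
    by rewrite linearZ /= !mxE enum_rankK.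
  rewrite -[LHS]evK.
  have [z [_ Uz]] := bij (fun i => 0 : E i).
  by rewrite -(Uz _ psi0) (Uz 0) ?rmorph0 ?mul0mx // => i; rewrite rmorph0.
pose h (r : 'I_(rk A)) : J := enum_val (widen_ord leJ r).
have h_inj : injective h.
  by apply: inj_comp; [exact: enum_val_inj | move=> x y /(congr1 val) /= /val_inj].
pose Q : 'M[K]_(rk A) := \matrix_(r, k) chi (h r) (ev (dl k)).
have Qunit : Q \in unitmx.
  rewrite -row_free_unit; apply: inj_row_free => c c0'; apply/rowP => r; rewrite mxE.
  move: r; apply: (@dedekind_independence _ _ _ (fun r => chi (h r))).
    by move=> x y /chi_inj/h_inj.
  move=> z; rewrite -[z]Kev.
  under eq_bigr do rewrite chiL mulr_sumr.
  rewrite exchange_big big1 // => k _.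
  under eq_bigr do rewrite mulrCA.
  rewrite -mulr_sumr; have := congr1 (fun M : 'rV_ _ => M 0 k) c0'; rewrite !mxE => e.
  by rewrite [X in _ * X](_ : _ = 0) ?mulr0 // -[RHS]e; apply: eq_bigr => i _; rewrite !mxE.
have Qeig z : Q *m map_mx (in_alg K) (nu z) = diag_mx (\row_r chi (h r) z) *m Q.
  apply/matrixP => r k; rewrite mul_diag_mx !mxE -rmorphM -ev_nu chiL.
  apply: eq_bigr => l _; rewrite !mxE mulrC; congr (_%:A * _).
  rewrite (bigD1 k) //= !mxE !eqxx mulr1 big1 ?addr0 // => i ik.
  by rewrite !mxE (negPf ik) mulr0.
(* Eigenvectors can be rescaled to clear the denominators of their coordinates. *)
have [N N0 NP] := common_denominator (fun x : 'I_(rk A) * 'I_(rk A) * 'I_(\dim {:K}) =>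
  coord (vbasis {:K}) x.2 (invmx Q x.1.1 x.1.2)).
have NK : N%:R != 0 :> K.
  by rewrite -(rmorph_nat (in_alg K)) fmorph_eq0 pnatr_eq0 -lt0n.
pose P := N%:R *: invmx Q.
have Punit : P \in unitmx by rewrite unitmxZ ?unitmx_inv // unitfE.
exists P; split=> //.
  move=> i j k; have := NP (i, j, k); rewrite !mxE /=.
  by rewrite -(rmorph_nat (in_alg K)) mulr_algl linearZ.
have Peig z : map_mx (in_alg K) (nu z) *m P = P *m diag_mx (\row_r chi (h r) z).
  rewrite -scalemxAr -scalemxAl; congr (_ *: _).
  by rewrite -[LHS](mulKmx Qunit) (mulmxA Q) Qeig mulmxK.
move=> t j; pose Pt := map_mx t P.
have Ptunit : Pt \in unitmx by rewrite map_unitmx.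
have Pteig z : map_mx ratr (nu z) *m Pt = Pt *m diag_mx (\row_r t (chi (h r) z)).
  rewrite -(eq_map_mx _ (fmorph_eq_rat (t \o in_alg K))) map_mx_comp -map_mxM Peig map_mxM.
  congr (_ *m _); apply/matrixP => a b; rewrite !mxE.
  by case: eqP => _; rewrite ?mulr1n ?mulr0n ?rmorph0.
set v := col j Pt.
have veig z : map_mx ratr (nu z) *m v = t (chi (h j) z) *: v.
  rewrite /v colE mulmxA Pteig -mulmxA scalemxAr; congr (_ *m _).
  apply/colP => r; rewrite mul_diag_mx !mxE; case: eqP => [->|_] //.
  by rewrite mulr0 mulr0.
have [v1 [v2 [H1 H2 v12]]] := H10_H01_split v.
have v1eig z : map_mx ratr (nu z) *m v1 = t (chi (h j) z) *: v1.
  apply/eqP; rewrite -subr_eq0; apply/eqP; apply: H10_H01_0.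
    by apply: H10B; [apply: End0_H10 | apply: H10Z].
  have -> : map_mx ratr (nu z) *m v1 - t (chi (h j) z) *: v1 =
      t (chi (h j) z) *: v2 - map_mx ratr (nu z) *m v2.
    have := veig z; rewrite v12 mulmxDr scalerDr => /eqP.
    rewrite -subr_eq0 opprD addrACA addr_eq0 opprB => /eqP.
    exact.
  by apply: H01B; [apply: H01Z | apply: End0_H01].
pose c := invmx Pt *m v1.
have v1c : v1 = Pt *m c by rewrite mulKVmx.
have c0' r : r != j -> c r 0 = 0.
  move=> rj; have [z nez] : exists z, chi (h r) z != chi (h j) z.
    apply: contrapT => nex; case/eqP: rj; apply: h_inj; apply: chi_inj => z.
    by apply/eqP; apply: contrapT => /negP ne; apply: nex; exists z.
  have := v1eig z; rewrite v1c mulmxA Pteig -mulmxA scalemxAr.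
  move=> /(congr1 (mulmx (invmx Pt))); rewrite !mulKmx // => /colP/(_ r).
  rewrite mul_diag_mx !mxE => /eqP; rewrite -subr_eq0 -mulrBl mulf_eq0 -rmorphB.
  by rewrite fmorph_eq0 subr_eq0 (negPf nez) => /eqP.
have v1v : v1 = c j 0 *: v.
  rewrite v1c; apply/colP => k; rewrite !mxE (bigD1 j) //= big1 ?addr0 1?mulrC ?mxE //.
  by move=> r rj; rewrite c0' // mulr0.
case: (eqVneq (c j 0) 0) => [cj0|cj0].
  by right; rewrite v12 v1v cj0 scale0r add0r.
by left; rewrite -[v](scalerK cj0) -v1v; apply: H10Z.
Qed.
End Eigenbasis.

(** * The abelian variety attached to a family of types *)

Section WeilVariety.
Variable R : realType.
Local Notation C := (complex R).
Variables (K : splittingFieldType rat) (iota : gal_of {:K}).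
Hypothesis ci : induces_conj R iota.
Variable t0 : {rmorphism K -> C}.
Local Notation G := (gal_of {:K}).
Local Notation n := (\dim {:K}).
Local Notation e := (tnth (vbasis {:K})).
Local Notation emb := (emb t0).

Variables (m : nat) (S : 'I_m -> G -> bool).
Hypothesis S_conj : forall k s, S k (iota * s)%g = ~~ S k s.

(** Exactly one of [s] and its conjugate belongs to the type of each coordinate. *)
Lemma sum_over_type (V : nmodType) (F : 'I_m -> G -> V) :
  \sum_(x : 'I_m * G | S x.1 x.2) (F x.1 x.2 + F x.1 (iota * x.2)%g) =
  \sum_k \sum_s F k s.
Proof.
rewrite pair_bigA /= big_split /= [RHS](bigID (fun x : 'I_m * G => S x.1 x.2)) /=.
congr (_ + _).
have bij : bijective (fun x : 'I_m * G => (x.1, (iota * x.2)%g)).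
  exists (fun x : 'I_m * G => (x.1, (iota^-1 * x.2)%g)) => [[k s]|[k s]] /=.
    by rewrite mulKg.
  by rewrite mulKVg.
rewrite [RHS](reindex _ (onW_bij _ bij)) /=.
by apply: eq_bigl => -[k s]; rewrite /= S_conj negbK.
Qed.

(** The dimension of the torus: one holomorphic coordinate for each pair (k, s)
    with [s] in the type [S k]. *)
Definition hol_dim := #|[pred x : 'I_m * G | S x.1 x.2]|.

Lemma hol_dim_double : (hol_dim + hol_dim)%N = #|{: 'I_m * 'I_n}|.
Proof.
rewrite card_prod !card_ord -(card_gal K) /hol_dim -sum1_card -big_split /=.
transitivity (\sum_(k : 'I_m) \sum_(s : G) 1)%N; first exact: (sum_over_type (fun _ _ => 1%N)).
by under eq_bigr do rewrite sum1_card; rewrite sum_nat_const card_ord.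
Qed.

Definition hol_index (c : 'I_hol_dim) : 'I_m * G := enum_val c.

Lemma hol_indexP c : S (hol_index c).1 (hol_index c).2. Proof. exact: (enum_valP c). Qed.

Lemma hol_index_inj : injective hol_index. Proof. exact: enum_val_inj. Qed.

Lemma hol_index_surj k s : S k s -> exists c, hol_index c = (k, s).
Proof.
move=> h; have hin : (k, s) \in [pred x : 'I_m * G | S x.1 x.2] by [].
by exists (enum_rank_in hin (k, s)); rewrite /hol_index enum_rankK_in.
Qed.

(** Rows of the period matrix are numbered by pairs: a coordinate of [K^m], and
    an element of a Q-basis of [K]. *)
Definition lattice_index (r : 'I_(hol_dim + hol_dim)) : 'I_m * 'I_n := enum_val (cast_ord hol_dim_double r).
Definition lattice_index_inv (x : 'I_m * 'I_n) : 'I_(hol_dim + hol_dim) :=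
  cast_ord (esym hol_dim_double) (enum_rank x).

Lemma lattice_indexK : cancel lattice_index lattice_index_inv.
Proof. by move=> r; rewrite /lattice_index /lattice_index_inv enum_valK cast_ordK. Qed.

Lemma lattice_index_invK : cancel lattice_index_inv lattice_index.
Proof. by move=> r; rewrite /lattice_index /lattice_index_inv cast_ordKV enum_rankK. Qed.

(** The rows form a Q-basis of [K^m], and generate the lattice. *)
Definition lattice_basis : 'M[K]_(hol_dim + hol_dim, m) :=
  \matrix_(r, k) (if (lattice_index r).1 == k then e (lattice_index r).2 else 0).

Lemma sum_rows (V : nmodType) (F : 'I_(hol_dim + hol_dim) -> V) :
  \sum_r F r = \sum_k \sum_j F (lattice_index_inv (k, j)).
Proof.
rewrite pair_bigA (reindex lattice_index_inv) /=.
  by apply: eq_big => // -[k j] _.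
by apply: onW_bij; exists lattice_index; [apply: lattice_index_invK | apply: lattice_indexK].
Qed.

Lemma lattice_basis_coords q (Y : 'M[K]_(q, m)) :
  map_mx (in_alg K) (\matrix_(i, r) coord (vbasis {:K}) (lattice_index r).2 (Y i (lattice_index r).1)) *m lattice_basis = Y.
Proof.
apply/matrixP => i k; rewrite !mxE sum_rows (bigD1 k) //= [X in _ + X]big1 ?addr0.
  rewrite [RHS]vbasis_sum; apply: eq_bigr => j _.
  by rewrite !mxE lattice_index_invK eqxx mulr_algl.
by move=> l lk; apply: big1 => j _; rewrite !mxE lattice_index_invK (negPf lk) mulr0.
Qed.

(** The rows stay independent over C in the product of all the completions of
    [K^m]: this is the independence of the embeddings. *)
Lemma lattice_basis_free (x : 'rV[C]_(hol_dim + hol_dim)) :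
  (forall s, x *m map_mx (emb s) lattice_basis = 0) -> x = 0.
Proof.
move=> x0; apply/rowP => r; rewrite mxE -[r]lattice_indexK; case: (lattice_index r) => k j; move: j.
apply: (@emb_coord_inj R K t0) => s.
have := congr1 (fun M : 'rV_ _ => M 0 k) (x0 s).
rewrite !mxE sum_rows (bigD1 k) //= [X in _ + X]big1 ?addr0 => [e0|l lk].
  by rewrite -[RHS]e0; apply: eq_bigr => j _; rewrite !mxE lattice_index_invK eqxx.
by apply: big1 => j _; rewrite !mxE lattice_index_invK (negPf lk) rmorph0 mulr0.
Qed.

Lemma ratr_mx q r (Z : 'M[rat]_(q, r)) s :
  map_mx (emb s) (map_mx (in_alg K) Z) = map_mx ratr Z.
Proof.
by rewrite -map_mx_comp; apply: eq_map_mx; exact: (fmorph_eq_rat (emb s \o in_alg K)).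
Qed.

Lemma lattice_basis_rat_inj q (Z Z' : 'M[rat]_(q, hol_dim + hol_dim)) :
  map_mx (in_alg K) Z *m lattice_basis = map_mx (in_alg K) Z' *m lattice_basis -> Z = Z'.
Proof.
move=> e; apply/row_matrixP => i; apply/eqP; rewrite -subr_eq0 -linearB /=.
have : map_mx (ratr : rat -> C) (row i (Z - Z')) = 0.
  apply: lattice_basis_free => s; rewrite -(ratr_mx _ s) -map_mxM map_row -row_mul.
  by rewrite map_mxB mulmxBl e subrr linear0 map_mx0.
by move/eqP; rewrite map_mx_eq0.
Qed.

(** The column of index (k, s) is the functional [x |-> emb s (x_k)] on the lattice;
    these are the functionals that are declared to be of type (1,0). *)
Definition weil_period : 'M[C]_(hol_dim + hol_dim, hol_dim) :=
  \matrix_(r, c) emb (hol_index c).2 (lattice_basis r (hol_index c).1).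

(** A real relation that holds under [s] also holds under the conjugate of [s], so
    that the embeddings in the type account for all of them. *)
Lemma weil_period_lattice (x : 'rV[R]_(hol_dim + hol_dim)) :
  map_mx (real_complex R) x *m weil_period = 0 -> x = 0.
Proof.
move=> x0; apply/eqP; rewrite -(map_mx_eq0 (real_complex R)); apply/eqP.
apply: lattice_basis_free => s; apply/rowP => k; rewrite [RHS]mxE.
have zS s' : S k s' -> (map_mx (real_complex R) x *m map_mx (emb s') lattice_basis) 0 k = 0.
  case/hol_index_surj=> c Dc; have := congr1 (fun M : 'rV_ _ => M 0 c) x0.
  by rewrite !mxE => e0; rewrite -[RHS]e0; apply: eq_bigr => r _; rewrite !mxE Dc.
case: (boolP (S k s)) => [/zS //|]; rewrite -S_conj => /zS /(congr1 Num.conj).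
rewrite rmorph0 !mxE rmorph_sum => e0; rewrite -[RHS]e0; apply: eq_bigr => r _.
rewrite !mxE rmorphM -(conj_emb ci) /= conjCK; congr (_ * _).
by apply/esym/eqP; rewrite -CrealE; apply/complex_realP; eexists.
Qed.

Lemma subr_conj (z : C) : z - Num.conj z = 2 * (complex.Im z)%:C%C * 'i.
Proof. exact: subcJ. Qed.

Lemma conj_antisym (a b w : C) : Num.conj w = w ->
  a * w * Num.conj b - Num.conj (a * w * Num.conj b) = w * (a * Num.conj b - Num.conj a * b).
Proof. by move=> wR; rewrite !rmorphM /= wR conjCK; ring. Qed.

Lemma sum_cols (V : nmodType) (F : 'I_m * G -> V) :
  \sum_(x | S x.1 x.2) F x = \sum_c F (hol_index c).
Proof.
rewrite (eq_bigl (mem [pred x : 'I_m * G | S x.1 x.2])) //.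
exact: big_enum_val.
Qed.

Section Polarization.
Variable xi : 'I_m -> K.
Hypothesis xi_anti : forall k, iota (xi k) = - xi k.
Hypothesis xi_pos : forall k s, S k s -> 0 < - 'i * emb s (xi k).

(** The diagonal of the Hermitian form; its imaginary part is, up to sign, half the trace
    form defined by [xi]. *)
Definition weight : 'rV[C]_hol_dim := \row_c (- 'i * emb (hol_index c).2 (xi (hol_index c).1)).

Lemma weight_pos c : 0 < weight 0 c.
Proof. by rewrite mxE; apply: xi_pos; apply: hol_indexP. Qed.

(** Up to a common factor, the imaginary part of the term indexed by (k, s) is the
    sum of the values of [s] and of its conjugate at the element [u k] of [K]; the
    anti-invariance of [xi k] makes the signs agree.  Hence the whole sum runs over all
    embeddings, and is a trace. *)
Lemma Im_form_rat r r' : exists q : rat,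
  complex.Im ((weil_period *m diag_mx weight *m map_mx Num.conj weil_period^T) r r') = ratr q.
Proof.
pose u k := xi k * (lattice_basis r k * iota (lattice_basis r' k)).
have [q Dq] := trace_rat t0 (\sum_k u k).
exists (- q / 2); apply: (@complexI R); set z := _ r r'.
have zq : z - Num.conj z = - 'i * ratr q.
  have -> : z = \sum_c emb (hol_index c).2 (lattice_basis r (hol_index c).1) * weight 0 c
                  * Num.conj (emb (hol_index c).2 (lattice_basis r' (hol_index c).1)).
    by rewrite /z mxE; apply: eq_bigr => c _; rewrite mul_mx_diag !mxE.
  rewrite -Dq rmorph_sum /= -sumrB; under [in RHS]eq_bigr do rewrite rmorph_sum.
  rewrite exchange_big /= -sum_over_type sum_cols mulr_sumr; apply: eq_bigr => c _.
  set k := (hol_index c).1; set s := (hol_index c).2.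
  have wR : Num.conj (weight 0 c) = weight 0 c.
    by apply/eqP; rewrite -CrealE gtr0_real ?weight_pos.
  rewrite (conj_antisym _ _ wR) -(conj_emb ci) !(emb_conj ci).
  have -> : iota (u k) = - xi k * (iota (lattice_basis r k) * lattice_basis r' k).
    by rewrite /u rmorphM /= xi_anti rmorphM /= (induces_conj_involutive ci).
  rewrite /u mxE -/k -/s !rmorphM rmorphN.
  by ring.
have := subr_conj z; rewrite zq => e0.
apply: (mulIf (neq0Ci C)); apply: (mulfI (_ : 2 != 0 :> C)); first by rewrite pnatr_eq0.
rewrite mulrA -e0.
have -> : (ratr (- q / 2))%:C%C = - ratr q / 2 :> C.
  transitivity (ratr (- q / 2) : C); first exact: (fmorph_eq_rat (real_complex R \o ratr)).
  by rewrite fmorph_div rmorphN rmorph_nat.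
by field.
Qed.

Lemma polarization_exists : exists H : 'M[C]_hol_dim,
    [/\ H \is hermsymmx,
        forall v : 'rV[C]_hol_dim, v != 0 -> 0 < (v *m H *m map_mx Num.conj v^T) 0 0 &
        forall i j, complex.Im ((weil_period *m H *m map_mx Num.conj weil_period^T) i j) \is a Num.int].
Proof.
have /fin_all_exists[q Dq] : forall x : 'I_(hol_dim + hol_dim) * 'I_(hol_dim + hol_dim), exists q : rat,
  complex.Im ((weil_period *m diag_mx weight *m map_mx Num.conj weil_period^T) x.1 x.2) = ratr q.
  by move=> x; apply: Im_form_rat.
have [N N0 NP] := common_denominator q.
have w0 c : 0 < N%:R * weight 0 c by rewrite mulr_gt0 ?weight_pos // ltr0n.
exists (N%:R *: diag_mx weight); split.
- apply/is_hermitianmxP; rewrite expr0 scale1r; apply/matrixP => i j; rewrite !mxE.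
  case: (eqVneq i j) => [->|ij]; last by rewrite !mulr0n mulr0 rmorph0.
  rewrite !mulr1n; apply/esym/eqP; rewrite -CrealE gtr0_real //.
  by have := w0 j; rewrite mxE.
- move=> v v0; have [c vc] : exists c, v 0 c != 0.
    apply: contrapT => nex; case/eqP: v0; apply/rowP => c; rewrite mxE.
    by apply/eqP; apply: contrapT => /negP h; apply: nex; exists c.
  have -> : (v *m (N%:R *: diag_mx weight) *m map_mx Num.conj v^T) 0 0 =
      \sum_c (N%:R * weight 0 c) * (v 0 c * Num.conj (v 0 c)).
    rewrite -scalemxAr -scalemxAl mxE mxE mulr_sumr; apply: eq_bigr => k _.
    rewrite mul_mx_diag !mxE; ring.
  have pos k : 0 <= N%:R * weight 0 k * (v 0 k * Num.conj (v 0 k)).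
    by rewrite mulr_ge0 ?mul_conjC_ge0 // ltW.
  rewrite (bigD1 c) //= ltr_pwDl ?sumr_ge0 // mulr_gt0 //.
  by rewrite mul_conjC_gt0.
move=> i j; rewrite -scalemxAr -scalemxAl mxE.
have -> (z : C) : complex.Im (N%:R * z) = N%:R * complex.Im z.
  by case: z => a b; rewrite -(rmorph_nat (real_complex R)) /= mul0r addr0.
rewrite (Dq (i, j)).
have -> : N%:R * ratr (q (i, j)) = ratr (N%:R * q (i, j)) :> R.
  by rewrite rmorphM rmorph_nat.
by have /intrP[k ->] := NP (i, j); rewrite ratr_int intr_int.
Qed.
End Polarization.

Lemma weil_polarized : exists H : 'M[C]_hol_dim,
    [/\ H \is hermsymmx,
        forall v : 'rV[C]_hol_dim, v != 0 -> 0 < (v *m H *m map_mx Num.conj v^T) 0 0 &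
        forall i j, complex.Im ((weil_period *m H *m map_mx Num.conj weil_period^T) i j) \is a Num.int].
Proof.
have /fin_all_exists[xi xiP] := fun k => imaginary_element ci t0 (S_conj k).
by apply: (@polarization_exists xi) => k; have [] := xiP k.
Qed.

Definition weil_abvar : abvar R := AbVar weil_period_lattice weil_polarized.

End WeilVariety.

(** * Complex multiplication and Weil classes on this variety *)

Lemma row'_mul (R : pzRingType) m n p (i : 'I_m) (X : 'M[R]_(m, n)) (L : 'M_(n, p)) :
  row' i (X *m L) = row' i X *m L.
Proof. by apply/matrixP => j k; rewrite !mxE; apply: eq_bigr => l _; rewrite mxE. Qed.

Lemma HC_wedge (R : realType) (A : abvar R) n (L : 'M[complex R]_(rk A, n)) : HC (wedge L).
Proof.
split=> [i X Y Z b c eX eY eZ|X i j ij eX]; rewrite /wedge.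
  apply: (determinant_multilinear (i0 := i)).
  - by rewrite !row_mul eX mulmxDl -!scalemxAl.
  - by rewrite !row'_mul eY.
  - by rewrite !row'_mul eZ.
apply: (determinant_alternate ij) => k.
by have := congr1 (fun M : 'rV_ _ => (M *m L) 0 k) eX; rewrite -!row_mul !mxE.
Qed.

Lemma HC_sum (R : realType) (A : abvar R) n (I : finType) (a : I -> complex R)
    (u : I -> altform A n) : (forall i, HC (u i)) -> HC (fun X => \sum_i a i * u i X).
Proof.
move=> Hu; split=> [i X Y Z b c eX eY eZ|X i j ij eX].
  rewrite !mulr_sumr -big_split /=; apply: eq_bigr => k _.
  by rewrite ((Hu k).1 i X Y Z b c eX eY eZ); ring.
by rewrite big1 // => k _; rewrite ((Hu k).2 X i j ij eX) mulr0.
Qed.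

(** For any nonzero functional [lam] the form [(x, y) |-> lam (x y)] is
    nondegenerate, since a multiple of a nonzero [x] is a vector on which [lam] does
    not vanish.  Thus the dual of [K] is free of rank one over [K]. *)
Lemma trace_form_dual (K : fieldExtType rat) :
  exists lam : {linear K -> rat^o}, forall w : 'I_(\dim {:K}) -> rat,
    exists a : K, (forall j, lam (a * tnth (vbasis {:K}) j) = w j) /\
      forall a', (forall j, lam (a' * tnth (vbasis {:K}) j) = w j) -> a' = a.
Proof.
pose e := vbasis {:K}.
have [j0 j0P] : exists j0, coord e j0 1 != 0.
  apply: contrapT => nex; have := oner_neq0 K; rewrite (coord_vbasis (memvf (1 : K))).
  rewrite big1 ?eqxx // => j _; case: (eqVneq (coord e j 1) 0) => [->|h]; first exact: scale0r.
  by case: nex; exists j.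
pose lam : {linear K -> rat^o} := coord e j0.
have inj a a' : (forall j, lam (a * tnth e j) = lam (a' * tnth e j)) -> a' = a.
  move=> h; apply/eqP; rewrite -subr_eq0; apply: contraT => nz.
  have lam0 x : lam ((a' - a) * x) = 0.
    rewrite (coord_vbasis (memvf x)) mulr_sumr linear_sum big1 // => j _.
    by rewrite -scalerAr linearZ /= -tnth_nth mulrBl linearB /= h subrr scaler0.
  by have := lam0 (a' - a)^-1; rewrite mulfV // => /eqP; rewrite (negPf j0P).
exists lam => w.
pose M : 'M[rat]_(\dim {:K}) := \matrix_(i, j) lam (tnth e i * tnth e j).
have lamM (v : 'rV[rat]_(\dim {:K})) j : (v *m M) 0 j = lam ((\sum_i v 0 i *: tnth e i) * tnth e j).
  rewrite mxE mulr_suml linear_sum; apply: eq_bigr => i _.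
  by rewrite mxE -scalerAl linearZ.
have Mfree : row_free M.
  apply: inj_row_free => v v0; apply/rowP => i; rewrite mxE.
  have s0 : \sum_i v 0 i *: tnth e i = 0.
    apply/esym; apply: inj => j; rewrite -lamM v0 mxE mul0r linear0 //.
  move/freeP: (basis_free (vbasisP {:K})) => /(_ (v 0)) h; apply: h.
  by rewrite -[RHS]s0; apply: eq_bigr => k _; rewrite -tnth_nth.
have Munit : M \in unitmx by rewrite -row_free_unit.
exists (\sum_i (\row_j w j *m invmx M) 0 i *: tnth e i); split=> [j|a' h].
  by rewrite -lamM mulmxKV // mxE.
by apply: inj => j; rewrite -lamM mulmxKV // mxE h.
Qed.

Section WeilAction.
Variable R : realType.
Local Notation C := (complex R).
Variables (K : splittingFieldType rat) (iota : gal_of {:K}).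
Hypothesis ci : induces_conj R iota.
Variable t0 : {rmorphism K -> C}.
Local Notation G := (gal_of {:K}).
Local Notation n := (\dim {:K}).
Local Notation e := (tnth (vbasis {:K})).
Local Notation emb := (emb t0).
Variables (m : nat) (S : 'I_m -> G -> bool).
Hypothesis S_conj : forall k s, S k (iota * s)%g = ~~ S k s.

Local Notation B := (weil_abvar ci t0 S_conj).
Local Notation lattice_basis := (lattice_basis S_conj).
Local Notation lattice_index := (lattice_index S_conj).
Local Notation lattice_index_inv := (lattice_index_inv S_conj).

(** Multiplication by [a] on [K^m], in the chosen Q-basis. *)
Definition mult_mx (a : K) : 'M[rat]_(rk B) :=
  \matrix_(i, r) coord (vbasis {:K}) (lattice_index r).2 ((a *: lattice_basis) i (lattice_index r).1).

Lemma mult_mx_basis a : map_mx (in_alg K) (mult_mx a) *m lattice_basis = a *: lattice_basis.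
Proof. exact: lattice_basis_coords. Qed.

Lemma mult_mx_zmod_morphism : zmod_morphism mult_mx.
Proof.
move=> a b; apply: (lattice_basis_rat_inj t0 (S_conj := S_conj)).
by rewrite map_mxB mulmxBl !mult_mx_basis scalerBl.
Qed.

Lemma mult_mx_monoid_morphism : monoid_morphism mult_mx.
Proof.
split=> [|a b]; apply: (lattice_basis_rat_inj t0 (S_conj := S_conj)); rewrite mult_mx_basis.
  by rewrite map_mx1 mul1mx scale1r.
by rewrite map_mxM -mulmxA mult_mx_basis -scalemxAr mult_mx_basis scalerA mulrC.
Qed.

HB.instance Definition _ := GRing.isZmodMorphism.Build K 'M[rat]_(rk B) mult_mx mult_mx_zmod_morphism.
HB.instance Definition _ := GRing.isMonoidMorphism.Build K 'M[rat]_(rk B) mult_mx mult_mx_monoid_morphism.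

Lemma mult_mx_emb a s : map_mx ratr (mult_mx a) *m map_mx (emb s) lattice_basis = emb s a *: map_mx (emb s) lattice_basis.
Proof. by rewrite -(ratr_mx t0 (mult_mx a) s) -map_mxM mult_mx_basis map_mxZ. Qed.

Definition emb_diag (a : K) : 'M[C]_(dim B) := diag_mx (\row_c emb (hol_index c).2 a).

Lemma mult_mx_period a : map_mx ratr (mult_mx a) *m period B = period B *m emb_diag a.
Proof.
apply/matrixP => r c; rewrite mul_mx_diag !mxE.
have := congr1 (fun M : 'M[C]_(_, _) => M r (hol_index c).1) (mult_mx_emb a (hol_index c).2).
rewrite !mxE [RHS]mulrC => e0; rewrite -[RHS]e0; apply: eq_bigr => k _.
by rewrite !mxE.
Qed.

Lemma mult_mx_End0 a : End0 (mult_mx a).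
Proof.
have [N N0 NP] := common_denominator (fun x : 'I_(rk B) * 'I_(rk B) => mult_mx a x.1 x.2).
have /fin_all_exists[z zP] : forall x, exists z : int, N%:R * mult_mx a x.1 x.2 = z%:~R.
  by move=> x; apply/intrP; apply: NP.
pose Z : 'M[int]_(rk B) := \matrix_(i, j) z (i, j).
have ZE : map_mx intr Z = N%:R *: mult_mx a.
  by apply/matrixP => i j; rewrite !mxE -(zP (i, j)) !mxE.
suff compat : period B *m (N%:R *: emb_diag a) = map_mx intr Z *m period B.
  by exists (Hom compat), N.
rewrite -ratr_mx_intr ZE map_mxZ /= ratr_nat -scalemxAl mult_mx_period scalemxAr //.
Qed.

(** [H^1] is the Q-dual of [K^m]; the functionals [lam] applied to the [m]
    coordinates form a K-basis of it. *)
Lemma dimE_H1_mult_mx : dimE_H1 mult_mx m.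
Proof.
have [lam lamP] := trace_form_dual K.
exists (fun k => \col_r lam (lattice_basis r k)); split=> // v _.
have lamA (q : rat) (x : K) : lam (in_alg K q * x) = q * lam x.
  by rewrite mulr_algl linearZ.
have actL a k r : (mult_mx a *m (\col_r lam (lattice_basis r k))) r 0 = lam (a * lattice_basis r k).
  rewrite mxE; have := congr1 (fun M : 'M[K]_(_, _) => M r k) (mult_mx_basis a).
  rewrite mxE [RHS]mxE => <-; rewrite linear_sum; apply: eq_bigr => r' _.
  by rewrite [in RHS]mxE lamA; congr (_ * _); rewrite mxE.
have sumE (a : {ffun 'I_m -> K}) k j :
    (\sum_l mult_mx (a l) *m (\col_r lam (lattice_basis r l))) (lattice_index_inv (k, j)) 0 = lam (a k * e j).
  rewrite summxE (bigD1 k) //= actL mxE lattice_index_invK eqxx big1 ?addr0 // => l lk.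
  by rewrite actL mxE lattice_index_invK eq_sym (negPf lk) mulr0 linear0.
have /fin_all_exists[a aP] := fun k => lamP (fun j => v (lattice_index_inv (k, j)) 0).
exists [ffun k => a k]; split=> [|a' Da'].
  apply/colP => r; rewrite -[r](lattice_indexK S_conj); case: (lattice_index r) => k j.
  by rewrite sumE ffunE (aP k).1.
apply/ffunP => k; rewrite ffunE; apply/esym/(aP k).2 => j.
by rewrite Da' sumE.
Qed.

(** In the coordinates (k, s), an element of K (x) C acts through its component at
    [s]. *)
Lemma EC_act_period (a : 'rV[C]_n) (q : 'cV_(dim B)) :
  EC_act mult_mx a (period B *m q) =
  period B *m \col_c ((\sum_j a 0 j * emb (hol_index c).2 (e j)) * q c 0).
Proof.
rewrite /EC_act; under eq_bigr do rewrite mulmxA mult_mx_period -mulmxA scalemxAr.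
rewrite -mulmx_sumr; congr (_ *m _); apply/colP => c; rewrite summxE !mxE mulr_suml.
by apply: eq_bigr => j _; rewrite mxE mul_diag_mx !mxE mulrA.
Qed.

(** For every [s] number the [p] coordinates whose type contains [s].  The i-th
    basis vector of [H^{1,0}] over K (x) C is the sum over [s] of the i-th of
    these coordinates. *)
Lemma Weil_type_mult_mx p : CM_field R K -> (forall s, #|[pred k | S k s]| = p) ->
  Weil_type mult_mx.
Proof.
move=> CMK cardS; split=> //; first exact: mult_mx_End0.
exists p.
pose f s (i : 'I_p) : 'I_m := enum_val (cast_ord (esym (cardS s)) i).
have fS s i : S (f s i) s by exact: (enum_valP (cast_ord (esym (cardS s)) i)).
have f_inj s : injective (f s) by move=> x y /enum_val_inj/cast_ord_inj.
have f_surj s k : S k s -> exists i, f s i = k.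
  move=> h; have hin : k \in [pred k | S k s] by [].
  exists (cast_ord (cardS s) (enum_rank_in hin k)).
  by rewrite /f cast_ordK enum_rankK_in.
have gE : forall x : 'I_p * G, exists c : 'I_(dim B), hol_index c = (f x.2 x.1, x.2).
  by case=> i s; apply: hol_index_surj; apply: fS.
have /fin_all_exists[g gP] := gE.
pose q i : 'cV[C]_(dim B) := \col_c ((hol_index c).1 == f (hol_index c).2 i)%:R.
exists (fun i => period B *m q i); split=> [i|v [Q ->]]; first by exists (q i).
have sumE (a : {ffun 'I_p -> 'rV[C]_n}) :
    \sum_i EC_act mult_mx (a i) (period B *m q i) =
    period B *m \col_c \sum_i (\sum_j a i 0 j * emb (hol_index c).2 (e j)) * q i c 0.
  under eq_bigr do rewrite EC_act_period.
  rewrite -mulmx_sumr; congr (_ *m _); apply/colP => c; rewrite summxE mxE.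
  by apply: eq_bigr => i _; rewrite !mxE.
have valE (F : 'I_p -> C) i s : \sum_i' F i' * q i' (g (i, s)) 0 = F i.
  rewrite (bigD1 i) //= mxE gP /= eqxx mulr1 big1 ?addr0 // => l li.
  by rewrite mxE gP /= (inj_eq (@f_inj s)) eq_sym (negPf li) mulr0.
have g_surj c : exists i, g (i, (hol_index c).2) = c.
  have [i Di] := f_surj _ _ (hol_indexP c); exists i.
  by apply: hol_index_inj; rewrite gP /= Di; case: (hol_index c).
have /fin_all_exists[a aP] := fun i => @emb_coord_surj R K t0 (fun s => Q (g (i, s)) 0).
exists [ffun i => \row_j a i j]; split=> [|a' Da'].
  rewrite sumE; congr (_ *m _); apply/colP => c; rewrite mxE.
  have [i Di] := g_surj c; rewrite -Di valE ffunE -aP gP /=.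
  by apply: eq_bigr => j _; rewrite mxE.
apply/ffunP => i; apply/rowP => j; rewrite ffunE mxE; apply/eqP; rewrite -subr_eq0; apply/eqP.
move: j; apply: (@emb_coord_inj R K t0) => s.
under eq_bigr do rewrite mulrBl.
rewrite sumrB aP; apply/eqP; rewrite subr_eq0; apply/eqP.
move: Da'; rewrite sumE => /eqP; rewrite -subr_eq0 -mulmxBr => /eqP/period_inj/eqP.
by rewrite subr_eq0 => /eqP->; rewrite mxE valE gP.
Qed.

(** The trace from [K] to Q of [c] times the wedge of the coordinates of [K^m]. *)
Definition weil_form (c : K) : altform B m :=
  fun X => \sum_s emb s c * @wedge R B m (map_mx (emb s) lattice_basis) X.

(** On rational vectors the form is the trace of an element of [K], hence rational. *)
Lemma W_E_weil_form c : W_E mult_mx (weil_form c).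
Proof.
split; first split.
- by apply: HC_sum => s; apply: HC_wedge.
- move=> X; pose D := \det (map_mx (in_alg K) X *m lattice_basis).
  have [q Dq] := trace_rat t0 (c * D); exists q; rewrite -Dq.
  apply: eq_bigr => s _; rewrite rmorphM /wedge; congr (_ * _).
  by rewrite -(ratr_mx t0 X s) -map_mxM det_map_mx.
exists #|{: G}|, (fun k => emb (enum_val k) c), (fun k => @wedge R B m (map_mx (emb (enum_val k)) lattice_basis)).
split=> [k|X]; last by rewrite /weil_form big_enum_val.
exists (emb (enum_val k)), (map_mx (emb (enum_val k)) lattice_basis); split=> // a.
exact: mult_mx_emb.
Qed.

Lemma Weil_class_weil_form p c : CM_field R K ->
  (forall s, #|[pred k | S k s]| = p) -> Weil_class (weil_form c).
Proof.
move=> CMK cardS; exists K, mult_mx; split.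
- exact: Weil_type_mult_mx cardS.
- exact: dimE_H1_mult_mx.
- exact: W_E_weil_form.
Qed.

(** The linear map with coordinates the columns of [Y] maps the lattice of [A] to
    the lattice by integrality, and is holomorphic because the functionals of
    type (1,0) on the target pull back to functionals of type (1,0). *)
Lemma hom_to_weil (A : abvar R) (Y : 'M[K]_(rk A, m)) :
  (forall i k j, coord (vbasis {:K}) j (Y i k) \is a Num.int) ->
  (forall k s, S k s -> H10 (col k (map_mx (emb s) Y))) ->
  exists f : avhom A B, forall s,
    map_mx intr (hom_rat f) *m map_mx (emb s) lattice_basis = map_mx (emb s) Y.
Proof.
move=> intY HY.
have /fin_all_exists[z zP] : forall x : 'I_(rk A) * 'I_m * 'I_n,
    exists z : int, coord (vbasis {:K}) x.2 (Y x.1.1 x.1.2) = z%:~R.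
  by move=> x; apply/intrP; apply: intY.
pose Z : 'M[int]_(rk A, rk B) := \matrix_(i, r) z (i, (lattice_index r).1, (lattice_index r).2).
have ZW s : map_mx intr Z *m map_mx (emb s) lattice_basis = map_mx (emb s) Y.
  rewrite -(lattice_basis_coords S_conj Y) map_mxM (ratr_mx t0); congr (_ *m _).
  apply/matrixP => i r; rewrite !mxE.
  by have /= -> := zP (i, (lattice_index r).1, (lattice_index r).2); rewrite ratr_int.
have /fin_all_exists[h hP] : forall c : 'I_(dim B), exists h : 'cV[C]_(dim A),
    col (hol_index c).1 (map_mx (emb (hol_index c).2) Y) = period A *m h.
  by move=> c; apply: HY; apply: hol_indexP.
suff compat : period A *m (\matrix_(i, c) h c i 0) = map_mx intr Z *m period B.
  by exists (Hom compat).
apply/matrixP => i c.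
transitivity (map_mx (emb (hol_index c).2) Y i (hol_index c).1).
  have := congr1 (fun M : 'cV_ _ => M i 0) (hP c); rewrite !mxE => ->.
  by apply: eq_bigr => k _; rewrite mxE.
rewrite -(ZW (hol_index c).2) !mxE; apply: eq_bigr => k _; by rewrite !mxE.
Qed.
End WeilAction.

(** * Alternating forms in a basis *)

(** No permutation can send [D] into the complement of [J], which is smaller than
    [D], so that every term of the Leibniz formula contains an entry of the block. *)
Lemma det_zero_block (F : comPzRingType) n (M : 'M[F]_n) (D J : {set 'I_n}) :
  (n < #|D| + #|J|)%N -> (forall i j, i \in D -> j \in J -> M i j = 0) -> \det M = 0.
Proof.
move=> big0 M0; apply: big1 => s _.
suff [i Di Ji] : exists2 i, i \in D & s i \in J.
  by rewrite (bigD1 i) //= M0 // mul0r mulr0.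
have : (s @: D) :&: J != set0.
  rewrite -card_gt0; have := cardsUI (s @: D) J.
  rewrite card_imset; last exact: perm_inj.
  have := subset_leq_card (subsetT (s @: D :|: J)); rewrite cardsT card_ord; lia.
case/set0Pn => _ /setIP[/imsetP[i Di ->] Ji]; by exists i.
Qed.

Section MultilinearForms.
Variables (R : realType) (A : abvar R) (q : nat) (t : altform A q).
Local Notation C := (complex R).
Local Notation N := (rk A).
Hypothesis Ht : HC t.

Definition set_row (k : 'I_q) (v : 'rV[C]_N) (X : 'M[C]_(q, N)) : 'M[C]_(q, N) :=
  \matrix_(i, j) if i == k then v 0 j else X i j.

Lemma row_set_row k v X : row k (set_row k v X) = v.
Proof. by apply/rowP => j; rewrite !mxE eqxx. Qed.

Lemma row'_set_row k v X : row' k (set_row k v X) = row' k X.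
Proof. by apply/matrixP => i j; rewrite !mxE eq_sym (negPf (neq_lift _ _)). Qed.

Lemma set_rowD k b c v w X :
  t (set_row k (b *: v + c *: w) X) = b * t (set_row k v X) + c * t (set_row k w X).
Proof. by apply: (Ht.1 k); rewrite ?row_set_row ?row'_set_row. Qed.

Lemma set_row_sum k (I : Type) (r : seq I) (a : I -> C) (v : I -> 'rV[C]_N) X :
  t (set_row k (\sum_(i <- r) a i *: v i) X) = \sum_(i <- r) a i * t (set_row k (v i) X).
Proof.
elim: r => [|i r IHr]; last first.
  by rewrite !big_cons -[X in _ + X]scale1r set_rowD mul1r IHr.
by rewrite !big_nil -[0 in LHS](addr0 0) -(scale0r 0) set_rowD !mul0r addr0.
Qed.

Lemma set_row_id k X : set_row k (row k X) X = X.
Proof. by apply/matrixP => i j; rewrite !mxE; case: eqP => [->|]. Qed.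

(** Both sides are multilinear in the rows of [Y], which reduces the statement, one row
    after the other, to the case where all the rows are unit vectors. *)
Lemma multilinear_expansion (Y : 'M[C]_(q, N)) (Z : 'M[C]_N) :
  t (Y *m Z) = \sum_(phi : {ffun 'I_q -> 'I_N}) (\prod_i Y i (phi i)) * t (rowsub phi Z).
Proof.
(* Induction on the number of leading rows that are not yet unit vectors. *)
pose dl j : 'rV[C]_N := delta_mx 0 j.
suff gen k : (k <= q)%N -> forall Y : 'M[C]_(q, N),
    (forall i : 'I_q, (k <= i)%N -> exists c, row i Y = dl c) ->
    t (Y *m Z) = \sum_(phi : {ffun 'I_q -> 'I_N}) (\prod_i Y i (phi i)) * t (rowsub phi Z).
  by apply: (gen q) => // i; rewrite leqNgt ltn_ord.
elim: k => [_|k IHk kq] {}Y HY.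
  have /fin_all_exists[c cP] := fun i => HY i isT.
  have Yc i j : Y i j = (j == c i)%:R.
    by have := congr1 (fun M : 'rV_ _ => M 0 j) (cP i); rewrite !mxE eqxx.
  rewrite (bigD1 [ffun i => c i]) //= [X in _ + X]big1 ?addr0 => [|phi phic].
    rewrite big1 ?mul1r => [|i _]; last by rewrite ffunE Yc eqxx.
    congr t; apply/matrixP => i j; rewrite !mxE (bigD1 (c i)) //= Yc eqxx mul1r big1 ?addr0 ?ffunE //.
    by move=> l lc; rewrite Yc (negPf lc) mul0r.
  have [i ne] : exists i, phi i != c i.
    apply: contrapT => nex; case/eqP: phic; apply/ffunP => i; rewrite ffunE.
    by apply/eqP; apply: contrapT => /negP h; apply: nex; exists i.
  by rewrite (bigD1 i) //= Yc (negPf ne) !mul0r.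
pose k' := Ordinal kq.
have rowdec : row k' Y = \sum_j Y k' j *: dl j.
  by rewrite [LHS]row_sum_delta; apply: eq_bigr => j _; rewrite mxE.
have stepY : t (Y *m Z) = \sum_j Y k' j * t (set_row k' (dl j) Y *m Z).
  have smul v : set_row k' v Y *m Z = set_row k' (v *m Z) (Y *m Z).
    apply/matrixP => i j; rewrite !mxE; case: (eqVneq i k') => [->|ne].
      by apply: eq_bigr => l _; rewrite !mxE eqxx.
    by apply: eq_bigr => l _; rewrite !mxE (negPf ne).
  rewrite -{1}(set_row_id k' Y) smul rowdec mulmx_suml.
  under eq_bigr do rewrite -scalemxAl.
  by rewrite set_row_sum; apply: eq_bigr => j _; rewrite smul.
rewrite stepY; under eq_bigr => j _.
  rewrite (IHk (ltnW kq)); last first.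
    move=> i; rewrite leq_eqVlt => /orP[/eqP ki|ki].
      by exists j; have -> : i = k' by [apply: val_inj]; rewrite row_set_row.
    have [c Dc] := HY i ki; exists c; rewrite -Dc.
    apply/rowP => l; rewrite !mxE; case: eqP => // ik.
    by move: ki; rewrite ik /= ltnn.
  rewrite mulr_sumr; over.
rewrite exchange_big /=; apply: eq_bigr => phi _.
under eq_bigr => j _ do rewrite mulrA.
rewrite -mulr_suml; congr (_ * _).
rewrite [RHS](bigD1 k') //= (bigD1 (phi k')) //= [X in _ + X]big1 ?addr0 => [|j jphi].
  rewrite (bigD1 k') //= !mxE !eqxx mul1r; congr (_ * _).
  by apply: eq_bigr => i ik; rewrite mxE (negPf ik).
by rewrite (bigD1 k') //= !mxE !eqxx eq_sym (negPf jphi) mul0r mulr0.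
Qed.

Lemma alternating_tperm i j X : i != j -> t (xrow i j X) = - t X.
Proof.
move=> ij; pose v := row i X; pose w := row j X.
(* Polarize: the form vanishes when both rows equal [v + w]. *)
pose Q a b := t (set_row i a (set_row j b X)).
have alt a : Q a a = 0.
  apply: (Ht.2 _ i j ij); rewrite row_set_row; apply/rowP => k.
  by rewrite !mxE eq_sym (negPf ij) eqxx.
have swp a b : set_row i a (set_row j b X) = set_row j b (set_row i a X).
  apply/matrixP => k l; rewrite !mxE; case: (eqVneq k i) => // ->; by rewrite (negPf ij).
have QDl a a' b : Q (a + a') b = Q a b + Q a' b.
  by rewrite /Q -[a in LHS]scale1r -[a' in LHS]scale1r set_rowD !mul1r.
have QDr a b b' : Q a (b + b') = Q a b + Q a b'.
  by rewrite /Q !swp -[b in LHS]scale1r -[b' in LHS]scale1r set_rowD !mul1r.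
have : Q (v + w) (v + w) = 0 by apply: alt.
rewrite QDl !QDr !alt add0r addr0 => /eqP; rewrite addrC addr_eq0 => /eqP e.
have -> : t X = Q v w.
  by rewrite /Q /v /w !set_row_id.
rewrite -e /Q; congr t; apply/matrixP => k l; rewrite !mxE permE /=.
by case: eqP => // _; case: eqP.
Qed.

Lemma alternating_perm (s : 'S_q) X : t (row_perm s X) = (-1) ^+ s * t X.
Proof.
have [ts -> /allP ats] := prod_tpermP s.
elim: ts ats X => [_ X|[i j] ts IHts ats X].
  by rewrite big_nil row_perm1 odd_perm1 mul1r.
rewrite big_cons row_permM odd_mul_tperm.
have ij : i != j by have := ats (i, j) (mem_head _ _).
rewrite -/(xrow i j _) /= alternating_tperm // IHts.
  by rewrite ij signr_addb mulN1r mulNr.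
by move=> x xts; apply: ats; rewrite inE xts orbT.
Qed.

(** Summing over all words rather than over subsets avoids choosing an order on
    each subset; the price is the factor [q!], as every rearrangement of a word
    contributes the same amount. *)
Lemma wedge_expansion (X : 'M[C]_(q, N)) (P : 'M[C]_N) : P \in unitmx ->
  q`!%:R * t X = \sum_(phi : {ffun 'I_q -> 'I_N})
     t (rowsub phi (invmx P)) * \det (X *m colsub phi P).
Proof.
move=> Pu; pose Y := X *m P.
have -> : t X = t (Y *m invmx P) by rewrite /Y mulmxK.
pose c (phi : {ffun 'I_q -> 'I_N}) := t (rowsub phi (invmx P)).
have detE (phi : {ffun 'I_q -> 'I_N}) : \det (X *m colsub phi P) =
    \sum_(s : 'S_q) (-1) ^+ s * \prod_i Y i (phi (s i)).
  apply: eq_bigr => s _; congr (_ * _); apply: eq_bigr => i _.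
  by rewrite !mxE; apply: eq_bigr => k _; rewrite mxE.
under [RHS]eq_bigr do rewrite detE mulr_sumr.
rewrite exchange_big /=.
have cst (s : 'S_q) : \sum_(phi : {ffun 'I_q -> 'I_N}) 
    t (rowsub phi (invmx P)) * ((-1) ^+ s * \prod_i Y i (phi (s i))) = t (Y *m invmx P).
  rewrite multilinear_expansion.
  pose h (s : 'S_q) (phi : {ffun 'I_q -> 'I_N}) := [ffun i => phi (s i)].
  have hK s' : cancel (h s') (h s'^-1)%g.
    by move=> phi; apply/ffunP => i; rewrite !ffunE permKV.
  rewrite (reindex (h s^-1)%g); last first.
    apply: onW_bij; exists (h s); last exact: hK.
    by move=> phi; apply/ffunP => i; rewrite !ffunE permK.
  apply: eq_bigr => phi _.
  have -> : rowsub (h s^-1%g phi) (invmx P) = row_perm s^-1 (rowsub phi (invmx P)).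
    by apply/matrixP => i j; rewrite !mxE ffunE.
  rewrite alternating_perm odd_permV mulrCA !mulrA -signr_addb addbb mul1r mulrC.
  by congr (_ * _); apply: eq_bigr => i _; rewrite ffunE permK.
under [RHS]eq_bigr do rewrite cst.
by rewrite sumr_const card_Sn mulr_natl.
Qed.
End MultilinearForms.

(** * Hodge classes and the decomposition *)

Section HodgeTypes.
Variables (R : realType) (A : abvar R).
Local Notation C := (complex R).
Local Notation N := (rk A).
Variables (P : 'M[C]_N) (Phi : pred 'I_N).
Hypothesis P_unit : P \in unitmx.
Hypothesis P10 : forall j, Phi j -> H10 (col j P).
Hypothesis P01 : forall j, ~~ Phi j -> H01 (col j P).

Lemma col_mul_mask (D : pred 'I_N) j :
  col j (P *m diag_mx (\row_i (D i)%:R)) = if D j then col j P else 0.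
Proof.
apply/colP => i; rewrite !mxE (bigD1 j) //= !mxE eqxx mulr1n big1 ?addr0.
  by case: (D j); rewrite ?mulr1 ?mulr0 mxE.
by move=> k kj; rewrite !mxE (negPf kj) mulr0n mulr0.
Qed.

Lemma H10_0 m : H10 (0 : 'M[C]_(rk A, m)).
Proof. by exists 0; rewrite mulmx0. Qed.

Lemma H01_0 m : H01 (0 : 'M[C]_(rk A, m)).
Proof. by apply/H01E; exists 0; rewrite mulmx0. Qed.

(** The components in [H^{1,0}] and [H^{0,1}] are read off from the coordinates in
    the eigenbasis [P]. *)
Lemma eigenbasis_split m (L : 'M[C]_(N, m)) : exists L1 L2, [/\ H10 L1, H01 L2, L = L1 + L2,
   forall j, ~~ Phi j -> row j (invmx P *m L1) = 0 &
   forall j, Phi j -> row j (invmx P *m L2) = 0].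
Proof.
pose D (Q : pred 'I_N) : 'M[C]_N := diag_mx (\row_i (Q i)%:R).
have kill (Q : pred 'I_N) j : ~~ Q j -> row j (invmx P *m (P *m D Q *m (invmx P *m L))) = 0.
  move=> Qj; rewrite -!mulmxA mulKmx // row_mul.
  suff -> : row j (D Q) = 0 by rewrite mul0mx.
  by apply/rowP => k; rewrite !mxE (negPf Qj) mul0rn.
exists (P *m D Phi *m (invmx P *m L)), (P *m D (predC Phi) *m (invmx P *m L)); split.
- apply: H10_mulr; apply: H10_cols => j; rewrite col_mul_mask.
  by case: ifP => [/P10 //|_]; apply: H10_0.
- apply: H01_mulr; apply: H01_cols => j; rewrite col_mul_mask.
  by case: ifP => [/P01 //|_]; apply: H01_0.
- rewrite -mulmxDl -mulmxDr; have -> : D Phi + D (predC Phi) = 1%:M.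
    apply/matrixP => i j; rewrite !mxE /= -mulrnDl; case: (Phi i); by rewrite ?addr0 ?add0r.
  by rewrite mulmx1 mulmxA mulmxV ?mul1mx.
- by move=> j; apply: kill.
- by move=> j Qj; apply: kill; rewrite /= negbK.
Qed.

Lemma H10_dual_row m (L : 'M[C]_(N, m)) j : H10 L -> ~~ Phi j -> row j (invmx P *m L) = 0.
Proof.
move=> HL Qj; have [L1 [L2 [H1 H2 e k1 k2]]] := eigenbasis_split L.
have L20 : L2 = 0 by apply: H10_H01_0 => //; rewrite -[L2](addKr L1) -e addrC; apply: H10B.
by rewrite e L20 addr0 k1.
Qed.

Lemma H01_dual_row m (L : 'M[C]_(N, m)) j : H01 L -> Phi j -> row j (invmx P *m L) = 0.
Proof.
move=> HL Qj; have [L1 [L2 [H1 H2 e k1 k2]]] := eigenbasis_split L.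
have L10 : L1 = 0 by apply: H10_H01_0 => //; rewrite -[L1](addrK L2) -e; apply: H01B.
by rewrite e L10 add0r k2.
Qed.

(** Rows of the inverse of [P] are the basis dual to the columns of [P], so those
    whose index is in [Phi] kill [H^{0,1}], and the others kill [H^{1,0}].  Hence
    the determinant giving the value of the wedge of [p] elements of
    [H^{1,0}] and [p] elements of [H^{0,1}] on such rows has two zero blocks, and it can
    be nonzero only if exactly [p] of the rows have their index in [Phi]. *)
Lemma Hpq_balanced p (t : altform A (p + p)) (phi : 'I_(p + p) -> 'I_N) : Hpq t ->
  t (rowsub phi (invmx P)) != 0 -> #|[pred k | Phi (phi k)]| = p.
Proof.
case=> [m [a [u [uP tE]]]] t0.
have [k uk] : exists k, u k (rowsub phi (invmx P)) != 0.
  apply: contrapT => nex; case/eqP: t0; rewrite tE big1 // => k _.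
  have [->|h] := eqVneq (u k (rowsub phi (invmx P))) 0; first by rewrite mulr0.
  by case: nex; exists k.
have [L [L' [HL HL' Du]]] := uP k; move: uk; rewrite Du /wedge => det0.
pose D := [set k | Phi (phi k)].
have cardD : (#|D| + #|~: D|)%N = (p + p)%N by rewrite cardsC card_ord.
have Dle : (#|D| <= p)%N.
  rewrite leqNgt; apply/negP => ltD; case/eqP: det0.
  apply: (det_zero_block (D := D) (J := [set rshift p j | j : 'I_p])).
    by rewrite card_imset ?card_ord ?ltn_add2r //; exact: rshift_inj.
  move=> i _ Di /imsetP[j _ ->]; rewrite mul_mx_row row_mxEr.
  rewrite inE in Di; have := H01_dual_row HL' Di.
  move/(congr1 (fun M : 'rV_ _ => M 0 j)); rewrite !mxE => e0; rewrite -[RHS]e0.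
  by apply: eq_bigr => l _; rewrite mxE.
have Cle : (#|~: D| <= p)%N.
  rewrite leqNgt; apply/negP => ltD; case/eqP: det0.
  apply: (det_zero_block (D := ~: D) (J := [set lshift p j | j : 'I_p])).
    by rewrite card_imset ?card_ord ?ltn_add2r //; exact: lshift_inj.
  move=> i _ Di /imsetP[j _ ->]; rewrite mul_mx_row row_mxEl.
  rewrite !inE in Di; have := H10_dual_row HL Di.
  move/(congr1 (fun M : 'rV_ _ => M 0 j)); rewrite !mxE => e0; rewrite -[RHS]e0.
  by apply: eq_bigr => l _; rewrite mxE.
have -> : #|[pred k | Phi (phi k)]| = #|D| by apply: eq_card => i; rewrite !inE.
lia.
Qed.
End HodgeTypes.

Lemma map_emb_conj (R : realType) (K : splittingFieldType rat) (iota : gal_of {:K})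
  (t0 : {rmorphism K -> complex R}) m n (P : 'M[K]_(m, n)) s : induces_conj R iota ->
  map_mx (emb t0 (iota * s)%g) P = map_mx (@Num.conj (complex R)) (map_mx (emb t0 s) P).
Proof. by move=> ci; apply/matrixP => i j; rewrite !mxE (conj_emb ci). Qed.

(** By rationality the expansion of [t] in the standard basis has coefficients in
    Q; substituting the dual basis gives an element of [K], and the substitution
    commutes with the embeddings. *)
Lemma rational_form_coefficients (R : realType) (A : abvar R) q (t : altform A q)
    (K : splittingFieldType rat) (t0 : {rmorphism K -> complex R}) (P : 'M[K]_(rk A)) :
  HQ t -> forall phi : {ffun 'I_q -> 'I_(rk A)},
  exists c : K, forall s, emb t0 s c = t (rowsub phi (invmx (map_mx (emb t0 s) P))).
Proof.
case=> Ht tQ phi.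
have /fin_all_exists[r rE] : forall psi : {ffun 'I_q -> 'I_(rk A)}, exists r : rat,
    t (rowsub psi 1%:M) = ratr r.
  move=> psi; have [r Dr] := tQ (rowsub psi 1%:M); exists r; rewrite -Dr.
  by congr t; apply/matrixP => i j; rewrite !mxE; case: eqP; rewrite ?rmorph1 ?rmorph0.
exists (\sum_(psi : {ffun 'I_q -> 'I_(rk A)})
  (\prod_i invmx P (phi i) (psi i)) * (r psi)%:A) => s.
rewrite -map_invmx -[rowsub _ _]mulmx1 multilinear_expansion // rmorph_sum.
apply: eq_bigr => psi _; rewrite rmorphM rE emb_rat; congr (_ * _).
by rewrite rmorph_prod; apply: eq_bigr => i _; rewrite !mxE.
Qed.

Theorem theorem1 (R : realType) (A : abvar R) (hA : CM_type A) :
  exists (I : finType) (B : I -> abvar R) (f : forall i, avhom A (B i)),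
    forall (p : nat) (t : altform A (p + p)), hodge_class t ->
      exists (D : {set I}) (u : forall i, altform (B i) (p + p)),
        (forall i, i \in D -> Weil_class (u i)) /\
        (forall X, t X = \sum_(i in D) pullback (f i) (u i) X).
Proof.
have [K [iota [P [CMK ci Punit Pint Ptype]]]] := CM_eigenbasis hA.
have [t0 _] := embedding_to_C R K.
pose N := rk A; pose Ps s := map_mx (emb t0 s) P.
have Psu s : Ps s \in unitmx by rewrite map_unitmx.
pose Phi s j := `[< H10 (col j (Ps s)) >].
have Phi10 s j : Phi s j -> H10 (col j (Ps s)) by move/asboolP.
have Phi01 s j : ~~ Phi s j -> H01 (col j (Ps s)).
  by case: (Ptype (emb t0 s) j) => // h /asboolPn.
have Phi_conj s j : Phi (iota * s)%g j = ~~ Phi s j.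
  have cP : col j (Ps (iota * s)%g) = map_mx (@Num.conj (complex R)) (col j (Ps s)).
    by rewrite /Ps map_emb_conj // map_col.
  apply/asboolP/idP => [h|/Phi01]; last by rewrite cP.
  apply/negP => /Phi10 h'; have v0 : col j (Ps s) = 0.
    by apply: H10_H01_0 => //; rewrite /H01 -cP.
  have := congr1 (mulmx (invmx (Ps s))) v0; rewrite colE mulKmx // mulmx0.
  by move/colP/(_ j); rewrite !mxE !eqxx => /eqP; rewrite oner_eq0.
pose I : finType := {m : 'I_N.+1 & {ffun 'I_m -> 'I_N}}.
pose B (i : I) : abvar R := weil_abvar ci t0 (S := fun k s => Phi s (tagged i k))
   (fun k s => Phi_conj s (tagged i k)).
have fE (i : I) : exists f : avhom A (B i), forall s,
    map_mx intr (hom_rat f) *m map_mx (emb t0 s) (lattice_basis (fun k s => Phi_conj s (tagged i k))) =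
    map_mx (emb t0 s) (colsub (tagged i) P).
  apply: hom_to_weil => [j k l|k s Sks]; first by rewrite mxE.
  by rewrite map_mxsub col_colsub; apply: Phi10.
have /fin_all_exists[f fP] := fE.
exists I, B, f => p t [tQ tpq].
have Ht := tQ.1.
have /fin_all_exists[c cP] := rational_form_coefficients t0 P tQ.
have bal phi s : c phi != 0 -> #|[pred k | Phi s (phi k)]| = p.
  move=> c0; apply: (Hpq_balanced (Psu s) (Phi10 s) (Phi01 s) tpq).
  by rewrite -cP fmorph_eq0.
(* The factor from summing over words, and the number of embeddings over which
   the expansion is averaged. *)
pose kap : rat := ((p + p)`!%:R * #|{: gal_of {:K}}|%:R)^-1.
have nzf : (p + p)`!%:R * #|{: gal_of {:K}}|%:R != 0 :> complex R.
  by rewrite mulf_neq0 // pnatr_eq0 -lt0n ?fact_gt0 // card_gal adim_gt0.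
pose term (phi : {ffun 'I_(p + p) -> 'I_N}) (X : 'M[complex R]_(p + p, N)) : complex R :=
  \sum_s emb t0 s (kap *: c phi) * \det (X *m map_mx (emb t0 s) (colsub phi P)).
have t_term X : t X = \sum_phi term phi X.
  apply: (mulfI nzf); rewrite mulr_sumr.
  transitivity (\sum_(s : gal_of {:K}) (p + p)`!%:R * t X).
    by rewrite sumr_const -mulr_natl; ring.
  rewrite [RHS](eq_bigr (fun phi => \sum_s emb t0 s (c phi) *
      \det (X *m map_mx (emb t0 s) (colsub phi P)))); last first.
    move=> phi _; rewrite mulr_sumr; apply: eq_bigr => s _.
    by rewrite embZ fmorphV rmorphM !rmorph_nat mulrA mulVKf.
  rewrite exchange_big /=; apply: eq_bigr => s _.
  rewrite (wedge_expansion Ht _ (Psu s)); apply: eq_bigr => phi _.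
  by rewrite cP map_mxsub.
(* Above the top degree every word repeats a letter, and all coefficients vanish. *)
case: (ltnP N (p + p)) => [ltN|leN].
  exists set0, (fun i _ => 0); split=> [i|X]; first by rewrite inE.
  rewrite big_set0 t_term big1 // => phi _; rewrite /term big1 // => s _.
  suff -> : c phi = 0 by rewrite scaler0 rmorph0 mul0r.
  apply: (fmorph_inj (emb t0 1%g)); rewrite cP rmorph0.
  have [i [j [ij eij]]] : exists i j, i != j /\ phi i = phi j.
    apply: contrapT => nex; have : injective phi.
      move=> i j e; apply/eqP; apply: contrapT => /negP ij.
      by apply: nex; exists i, j.
    by move/leq_card; rewrite !card_ord leqNgt ltN.
  by apply: (Ht.2 _ i j ij); apply/rowP => k; rewrite !mxE eij.
have ltq : (p + p < N.+1)%N by [].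
pose g (phi : {ffun 'I_(p + p) -> 'I_N}) : I :=
  existT (fun m : 'I_N.+1 => {ffun 'I_m -> 'I_N}) (Ordinal ltq) phi.
have g_inj : injective g by move=> phi psi; apply: eq_from_Tagged.
(* The variety [B (g phi)] has [p + p] coordinates by computation; other indices
   do not enter the sum, and get the zero form. *)
have uE (i : I) : exists u : altform (B i) (p + p), forall phi, i = g phi ->
    c phi != 0 -> Weil_class u /\ forall X, pullback (f i) u X = term phi X.
  case: (pselect (exists phi, i = g phi)) => [[phi ->]|nex]; last first.
    by exists (fun _ => 0) => phi e; case: nex; exists phi.
  exists (weil_form (kap *: c phi)) => psi /g_inj <- c0; split.
    apply: Weil_class_weil_form CMK _ => s; exact: bal.
  move=> X; rewrite /pullback /weil_form /wedge /term.
  apply: eq_bigr => s _; congr (_ * _).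
  by rewrite -mulmxA; have /= -> := fP (g phi) s.
have /fin_all_exists[u uP] := uE.
exists [set g phi | phi in [pred phi | c phi != 0]], u; split.
  by move=> i /imsetP[phi c0 e]; have [] := uP i phi e c0.
move=> X; rewrite big_imset /=; last by move=> x y _ _; apply: g_inj.
rewrite t_term (bigID (fun phi => c phi != 0)) /= [X in _ + X]big1 ?addr0.
  by apply: eq_bigr => phi c0; have [_ ->] := uP _ phi (erefl _) c0.
move=> phi; rewrite negbK => /eqP c0; rewrite /term big1 // => s _.
by rewrite c0 scaler0 rmorph0 mul0r.
Qed.
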